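(* Directed $a$-Based SNA admits a polynomial-time approximation algorithm with ratio $H(|D|)$ for edge-costs and ratio $H(\min\{r(D),|D|\cdot p_{\max}\})$ for node-costs. Consequently, directed SSL admits a polynomial-time approximation algorithm with ratio $H\left(\min\{\sum_{v\in V}d_v,\ |V|\cdot\max_{u\in V}p_u\}\right)$.
   Context: $H(j)=\sum_{i=1}^j 1/i$. For a directed graph $H$ with node capacities $q$ and distinct nodes $s,v$, $\lambda^q_H(s,v)$ is the maximum $s$–$v$ flow value with unit edge capacities and capacity $q_u$ on each node $u\notin\{s,v\}$. Directed $a$-Based SNA: given a directed graph $G=(V,E)$, node capacities $q_u\ge1$, a node $a$, a set $F$ of edges on $V$ all leaving $a$ (parallel edges allowed), a set $D$ of demand pairs with integer requirements $r_{sv}$, and costs either on $F$ (edge-costs: $c(I)=\sum_{e\in I}c_e$) or on $V$ (node-costs: $c(I)$ is the cost of the set of endnodes of $I$), find $I\subseteq F$ of minimum cost with $\lambda^q_{G+I}(s,v)\ge r_{sv}$ for all $sv\in D$. $r(D)=\sum_{sv\in D}r_{sv}$ and $p_{\max}$ is the maximum number of parallel edges in $F$. Directed SSL: given a directed graph $G=(V,E)$, node-costs $c_v\ge0$, integer demands $d_v\ge0$, integers $1\le q_u\le p_u\le k=\max_v d_v$; for $S\subseteq V$, $\lambda^{p,q}_G(S,v)=\lambda^q_{G'}(s,v)$ where $G'$ adds a new node $s$ and $p_u$ parallel edges from $s$ to each $u\in S$; find $S$ minimizing $\sum_{v\in S}c_v$ with $\lambda^{p,q}_G(S,v)\ge d_v$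 for all $v$. Approximation ratio $\rho$: polynomial-time algorithm returning a feasible solution of cost at most $\rho$ times the optimum. *)

(* Defs.v *)
From Stdlib Require Import BinNums BinNat.
From HB Require Import structures.
From mathcomp Require Import all_boot all_order all_algebra.

Set Implicit Arguments.
Unset Strict Implicit.
Unset Printing Implicit Defensive.

Import Order.TTheory GRing.Theory Num.Theory.

(** * Polynomial-time computation

    Programs are variable-free functional programs (in the style of Backus's
    FP) on binary trees, with composition, pairing, conditional and while.
    [eval p x y t] says that [p] run on [x] halts with output [y] after time
    [t].  Every step is charged the size of the tree it acts on, so [t] also
    bounds the size of every intermediate value; the model therefore simulates
    Turing machines, and is simulated by them, with polynomial overhead. *)

Inductive tree := Leaf | Node of tree & tree.

Fixpoint tree_size (x : tree) : nat :=
  if x is Node l r then (tree_size l + tree_size r).+1 else 1.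

Definition tree_head (x : tree) : tree := if x is Node l _ then l else Leaf.
Definition tree_tail (x : tree) : tree := if x is Node _ r then r else Leaf.

Inductive prog :=
| Pid
| Pleaf
| Phead
| Ptail
| Pcomp of prog & prog
| Ppair of prog & prog
| Pif of prog & prog & prog
| Pwhile of prog & prog.

Inductive eval : prog -> tree -> tree -> nat -> Prop :=
| Eid x : eval Pid x x (tree_size x)
| Eleaf x : eval Pleaf x Leaf (tree_size x)
| Ehead x : eval Phead x (tree_head x) (tree_size x)
| Etail x : eval Ptail x (tree_tail x) (tree_size x)
| Ecomp p1 p2 x y z t1 t2 :
    eval p1 x y t1 -> eval p2 y z t2 ->
    eval (Pcomp p1 p2) x z (tree_size x + t1 + t2)
| Epair p1 p2 x y z t1 t2 :
    eval p1 x y t1 -> eval p2 x z t2 ->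
    eval (Ppair p1 p2) x (Node y z) (tree_size x + t1 + t2)
| Eif_node b p1 p2 x l r y t1 t2 :
    eval b x (Node l r) t1 -> eval p1 x y t2 ->
    eval (Pif b p1 p2) x y (tree_size x + t1 + t2)
| Eif_leaf b p1 p2 x y t1 t2 :
    eval b x Leaf t1 -> eval p2 x y t2 ->
    eval (Pif b p1 p2) x y (tree_size x + t1 + t2)
| Ewhile_stop b p x t :
    eval b x Leaf t -> eval (Pwhile b p) x x (tree_size x + t)
| Ewhile_step b p x l r y z t1 t2 t3 :
    eval b x (Node l r) t1 -> eval p x y t2 -> eval (Pwhile b p) y z t3 ->
    eval (Pwhile b p) x z (tree_size x + t1 + t2 + t3).

Local Open Scope ring_scope.

(** Numbers are encoded in binary, least significant bit first. *)

Definition enc_bool (b : bool) : tree := if b then Node Leaf Leaf else Leaf.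

Definition enc_seq (A : Type) (enc : A -> tree) (s : seq A) : tree :=
  foldr (fun x t => Node (enc x) t) Leaf s.

Definition enc_pair (A B : Type) (encA : A -> tree) (encB : B -> tree)
  (x : A * B) : tree := Node (encA x.1) (encB x.2).

Fixpoint pos_bits (p : positive) : seq bool :=
  match p with
  | xH => [:: true]
  | xO p' => false :: pos_bits p'
  | xI p' => true :: pos_bits p'
  end.

Definition nat_bits (m : nat) : seq bool :=
  if N.of_nat m is Npos p then pos_bits p else [::].

Definition enc_nat (m : nat) : tree := enc_seq enc_bool (nat_bits m).

Definition enc_int (z : int) : tree := Node (enc_bool (z < 0)) (enc_nat `|z|%N).

Definition enc_rat (c : rat) : tree := Node (enc_int (numq c)) (enc_int (denq c)).

Definition enc_ord (n : nat) (i : 'I_n) : tree := enc_nat i.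

Definition enc_fun (A : Type) (enc : A -> tree) (n : nat) (f : 'I_n -> A) : tree :=
  enc_seq enc [seq f i | i <- enum 'I_n].

Definition enc_set (n : nat) (S : {set 'I_n}) : tree :=
  enc_fun enc_bool (fun i => i \in S).

Definition enc_edges (n : nat) : seq ('I_n * 'I_n) -> tree :=
  enc_seq (enc_pair (@enc_ord n) (@enc_ord n)).

(** * Approximation algorithms *)

Record min_problem := MinProblem {
  instance : Type;
  solution : instance -> Type;
  feasible : forall x : instance, solution x -> Prop;
  cost : forall x : instance, solution x -> rat;
  enc_instance : instance -> tree;
  enc_solution : forall x : instance, solution x -> tree }.

(** The algorithm must halt within the time bound on every instance; on
    instances without feasible solutions its output is unconstrained. *)
Definition poly_time_approx (P : min_problem) (ratio : instance P -> rat) : Prop :=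
  exists (p : prog) (C k : nat), forall x : instance P,
  exists (y : tree) (t : nat),
    [/\ eval p (enc_instance x) y t,
        (t <= C * tree_size (enc_instance x) ^ k)%N
      & (exists S : solution x, feasible S) ->
        exists S : solution x,
          [/\ y = enc_solution S,
              feasible S
            & forall S' : solution x, feasible S' -> cost S <= ratio x * cost S']].

Definition H (j : nat) : rat := \sum_(1 <= i < j.+1) i%:R^-1.

(** * Flows

    A directed (multi)graph on [V] is the list of its edges (tail, head);
    parallel edges are repeated entries, and a flow is indexed by positions. *)

Section Flow.

Variables (V : finType) (E : seq (V * V)) (q : V -> nat) (s v : V).

Definition edge (e : 'I_(size E)) : V * V := tnth (in_tuple E) e.

Definition inflow (f : 'I_(size E) -> rat) (u : V) : rat :=
  \sum_(e | (edge e).2 == u) f e.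

Definition outflow (f : 'I_(size E) -> rat) (u : V) : rat :=
  \sum_(e | (edge e).1 == u) f e.

Definition is_flow (f : 'I_(size E) -> rat) : Prop :=
  (forall e, 0 <= f e <= 1) /\
  (forall u, u != s -> u != v ->
     inflow f u = outflow f u /\ inflow f u <= (q u)%:R).

Definition flow_value (f : 'I_(size E) -> rat) : rat := outflow f s - inflow f s.

Definition is_lambda (l : rat) : Prop :=
  (exists f, is_flow f /\ flow_value f = l) /\
  (forall f, is_flow f -> flow_value f <= l).

Definition lambda_ge (m : nat) : Prop := exists2 l, is_lambda l & m%:R <= l.

End Flow.

(** * Directed a-Based SNA *)

Record sna := Sna {
  sna_n : nat;
  sna_E : seq ('I_sna_n * 'I_sna_n);
  sna_q : 'I_sna_n -> nat;
  sna_a : 'I_sna_n;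
  sna_F : seq ('I_sna_n * 'I_sna_n);
  sna_D : {set 'I_sna_n * 'I_sna_n};
  sna_r : 'I_sna_n * 'I_sna_n -> nat;
  sna_q_ge1 : forall u, (1 <= sna_q u)%N;
  sna_F_from_a : forall e, e \in sna_F -> e.1 = sna_a;
  sna_D_neq : forall s v, (s, v) \in sna_D -> s != v }.

(** Edge sets [I] are sets of positions in the list [F], so that parallel edges
    are chosen independently. *)
Definition sna_edges (x : sna) (I : {set 'I_(size (sna_F x))}) :
    seq ('I_(sna_n x) * 'I_(sna_n x)) :=
  [seq edge i | i <- enum I].

Definition sna_feasible (x : sna) (I : {set 'I_(size (sna_F x))}) : Prop :=
  forall s v, (s, v) \in sna_D x ->
    lambda_ge (sna_E x ++ sna_edges I) (@sna_q x) s v (sna_r (s, v)).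

Definition sna_rD (x : sna) : nat := (\sum_(sv in sna_D x) sna_r sv)%N.

Definition sna_pmax (x : sna) : nat := (\max_(e <- sna_F x) count_mem e (sna_F x))%N.

Definition endnodes (x : sna) (I : {set 'I_(size (sna_F x))}) : {set 'I_(sna_n x)} :=
  [set (edge i).1 | i in I] :|: [set (edge i).2 | i in I].

Definition enc_sna (x : sna) : tree :=
  Node (enc_nat (sna_n x))
 (Node (enc_edges (sna_E x))
 (Node (enc_fun enc_nat (@sna_q x))
 (Node (enc_ord (sna_a x))
 (Node (enc_edges (sna_F x))
       (enc_seq (enc_pair (enc_pair (@enc_ord _) (@enc_ord _)) enc_nat)
                [seq (sv, sna_r sv) | sv <- enum (sna_D x)]))))).

Record sna_ec := SnaEc {
  ec_sna :> sna;
  ec_c : 'I_(size (sna_F ec_sna)) -> rat;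
  ec_c_ge0 : forall e, 0 <= ec_c e }.

Definition sna_edge_costs : min_problem := {|
  instance := sna_ec;
  solution := fun x => {set 'I_(size (sna_F x))};
  feasible := fun x I => sna_feasible I;
  cost := fun x I => \sum_(e in I) ec_c e;
  enc_instance := fun x => Node (enc_sna x) (enc_fun enc_rat (@ec_c x));
  enc_solution := fun x I => enc_set I |}.

Record sna_nc := SnaNc {
  nc_sna :> sna;
  nc_c : 'I_(sna_n nc_sna) -> rat;
  nc_c_ge0 : forall u, 0 <= nc_c u }.

Definition sna_node_costs : min_problem := {|
  instance := sna_nc;
  solution := fun x => {set 'I_(size (sna_F x))};
  feasible := fun x I => sna_feasible I;
  cost := fun x I => \sum_(u in endnodes I) nc_c u;
  enc_instance := fun x => Node (enc_sna x) (enc_fun enc_rat (@nc_c x));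
  enc_solution := fun x I => enc_set I |}.

(** * Directed SSL *)

Record ssl := Ssl {
  ssl_n : nat;
  ssl_E : seq ('I_ssl_n * 'I_ssl_n);
  ssl_c : 'I_ssl_n -> rat;
  ssl_d : 'I_ssl_n -> nat;
  ssl_q : 'I_ssl_n -> nat;
  ssl_p : 'I_ssl_n -> nat;
  ssl_c_ge0 : forall v, 0 <= ssl_c v;
  ssl_qp : forall u, (1 <= ssl_q u <= ssl_p u)%N;
  ssl_pk : forall u, (ssl_p u <= \max_v ssl_d v)%N }.

(** The new node is [None]; its capacity plays no role, as it is the source. *)
Definition ssl_ext_edges (x : ssl) (S : {set 'I_(ssl_n x)}) :
    seq (option 'I_(ssl_n x) * option 'I_(ssl_n x)) :=
  [seq (Some e.1, Some e.2) | e <- ssl_E x] ++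
  flatten [seq nseq (ssl_p u) (None, Some u) | u <- enum S].

Definition ssl_ext_q (x : ssl) (u : option 'I_(ssl_n x)) : nat :=
  if u is Some w then ssl_q w else 0%N.

Definition ssl_feasible (x : ssl) (S : {set 'I_(ssl_n x)}) : Prop :=
  forall v : 'I_(ssl_n x),
    lambda_ge (ssl_ext_edges S) (@ssl_ext_q x) None (Some v) (ssl_d v).

Definition enc_ssl (x : ssl) : tree :=
  Node (enc_nat (ssl_n x))
 (Node (enc_edges (ssl_E x))
 (Node (enc_fun enc_rat (@ssl_c x))
 (Node (enc_fun enc_nat (@ssl_d x))
 (Node (enc_fun enc_nat (@ssl_q x))
       (enc_fun enc_nat (@ssl_p x)))))).

Definition directed_ssl : min_problem := {|
  instance := ssl;
  solution := fun x => {set 'I_(ssl_n x)};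
  feasible := fun x S => ssl_feasible S;
  cost := fun x S => \sum_(v in S) ssl_c v;
  enc_instance := enc_ssl;
  enc_solution := fun x S => enc_set S |}.

(* Main.v *)
(** Splitting every node [u] into [(u, false) -> (u, true)] with [q u] parallel
    arcs turns all requirements into max-flow values in plain multigraphs with
    unit capacities.  There a max flow is found by repeatedly reversing an s-t
    path: each reversal lowers every s-t cut by exactly one, and one stops when
    some cut is empty; this yields max-flow min-cut with integral flows.

    All edges of [F] leave the same node [a], so uncrossing minimum cuts shows
    that the max-flow value is submodular in the chosen edges; hence so is
    [sum_sv min (r sv) (maxflow sv)].  Wolsey's greedy algorithm for submodular
    covering has ratio [H k], where [k] bounds the gain of a single item: an
    edge gains at most 1 per demand, and a node (all parallel edges from [a] to
    it) at most [min (r sv) pmax].  With node-costs, the item of [a] itself is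
    given cost 0, as [a] is paid for by every nonempty solution.

    In SSL the multiplicities [p u] are binary numbers.  Apart from the [p v]
    arcs from the source straight to [v], at most [|E|] units of flow can reach
    [v], so truncating [p] and [q] at [|E| + 1] and shifting the demand at [v]
    accordingly gives an equivalent instance of polynomial size. *)

From Stdlib Require Import BinNums BinNat.
Require Import Defs.
From mathcomp Require Import all_boot all_order all_algebra.
From mathcomp Require Import zify ring lra.

Set Implicit Arguments.
Unset Strict Implicit.
Unset Printing Implicit Defensive.

Import Order.TTheory GRing.Theory Num.Theory.

(** * Polynomial-time functions on encoded data *)

(** Running time has to be established inside the program model, so each algorithm is an ordinary
    function on plain data (numbers, pairs, lists), and closure properties of [poly] supply its
    program. Iterating a polynomial-time step polynomially often need not stay polynomial, because
    intermediate values can blow up. Every loop is therefore a left fold over an already computed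
    list, together with a bound on all its accumulators. Search, augmentation and greedy selection
    thus run for a number of rounds fixed by the length of a list, and their invariants show that
    this is enough. Since numbers are binary, a capacity can be unrolled into parallel arcs only
    after truncation. This concerns the node capacities of SNA as well, where the number of
    available edges is a harmless bound. The combinatorial part argues with cuts throughout: the
    coverage depends on a list of arcs only through its cut values, so the order in which items or
    edges are listed never matters. *)

Class enc (A : Type) := encode : A -> tree.
#[export] Hint Mode enc ! : typeclass_instances.

#[export] Instance enc_b : enc bool := enc_bool.
#[export] Instance enc_n : enc nat := enc_nat.
#[export] Instance enc_s A (eA : enc A) : enc (seq A) := enc_seq eA.
#[export] Instance enc_p A B (eA : enc A) (eB : enc B) : enc (A * B) := enc_pair eA eB.

Definition sz A {eA : enc A} (x : A) := tree_size (encode x).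

Lemma tree_size_gt0 x : 0 < tree_size x.
Proof. by case: x. Qed.

Lemma sz_gt0 A {eA : enc A} (x : A) : 0 < sz x.
Proof. exact: tree_size_gt0. Qed.

Lemma sz_pair A B {eA : enc A} {eB : enc B} (x : A) (y : B) :
  sz (x, y) = (sz x + sz y).+1.
Proof. by []. Qed.

Lemma sz_cons A {eA : enc A} (x : A) (s : seq A) : sz (x :: s) = (sz x + sz s).+1.
Proof. by []. Qed.

Lemma eval_size p x y t : eval p x y t -> tree_size y <= t.
Proof.
elim=> {p x y t} //=; try lia.
- by move=> x; exact: tree_size_gt0.
- by case=> //= l r; lia.
- by case=> //= l r; lia.
- by move=> p1 p2 x y z t1 t2 _ ? _ ?; have := tree_size_gt0 x; lia.
Qed.

Definition polybound A {eA : enc A} (g : A -> nat) :=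
  exists C k, forall x, g x <= C * sz x ^ k.

Section PolyBound.
Context {A : Type} {eA : enc A}.
Implicit Types g h : A -> nat.

Lemma polybound_le g h : polybound h -> (forall x, g x <= h x) -> polybound g.
Proof. by move=> [C [k H1]] H2; exists C, k => x; apply: leq_trans (H1 x). Qed.

Lemma polybound_const c : polybound (fun _ : A => c).
Proof. by exists c, 0 => x; rewrite expn0 muln1. Qed.

Lemma polybound_add g h : polybound g -> polybound h -> polybound (fun x => g x + h x).
Proof.
move=> [C [k H1]] [C' [k' H2]]; exists (C + C'), (k + k') => x.
have s0 := sz_gt0 x.
rewrite mulnDl; apply: leq_add.
  by apply: leq_trans (H1 x) _; rewrite leq_mul2l leq_pexp2l ?orbT ?leq_addr.
by apply: leq_trans (H2 x) _; rewrite leq_mul2l leq_pexp2l ?orbT ?leq_addl.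
Qed.

Lemma polybound_mul g h : polybound g -> polybound h -> polybound (fun x => g x * h x).
Proof.
move=> [C [k H1]] [C' [k' H2]]; exists (C * C'), (k + k') => x.
by rewrite expnD mulnACA leq_mul.
Qed.

Lemma polybound_exp g n : polybound g -> polybound (fun x => g x ^ n).
Proof.
move=> pg; elim: n => [|n IH]; first exact: (polybound_const 1).
by apply: polybound_le (polybound_mul pg IH) _ => x; rewrite expnS.
Qed.

Lemma polybound_sz : polybound (fun x : A => sz x).
Proof. by exists 1, 1 => x; rewrite mul1n expn1. Qed.

End PolyBound.

Ltac pbound := repeat first
  [ assumption | exact: polybound_sz | exact: polybound_const
  | apply: polybound_add | apply: polybound_mul | apply: polybound_exp ].

(** Time is measured in the encoded size of the argument and bounds the size of the result
    ([eval_size]); this is why such functions compose. *)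
Variant poly A B {eA : enc A} {eB : enc B} (f : A -> B) : Prop :=
  Poly (p : prog) (g : A -> nat) of polybound g &
    (forall x, exists2 t, eval p (encode x) (encode (f x)) t & t <= g x).

Lemma poly_polybound A B {eA : enc A} {eB : enc B} (f : A -> B) :
  poly f -> polybound (fun x => sz (f x)).
Proof.
move=> [p g pg H]; apply: polybound_le pg _ => x.
by have [t /eval_size e le] := H x; apply: leq_trans e le.
Qed.

Lemma polybound_comp A B {eA : enc A} {eB : enc B} (f : A -> B) (g : B -> nat) :
  poly f -> polybound g -> polybound (fun x => g (f x)).
Proof.
move=> /poly_polybound pf [C [k H]].
apply: polybound_le (polybound_mul (polybound_const C) (polybound_exp k pf)) _ => x.
exact: H.
Qed.

Lemma poly_comp A B C {eA : enc A} {eB : enc B} {eC : enc C} (f : A -> B) (h : B -> C) :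
  poly h -> poly f -> poly (fun x => h (f x)).
Proof.
move=> [p2 g2 pg2 H2] pf; have [p1 g1 pg1 H1] := pf.
apply: (@Poly _ _ _ _ _ (Pcomp p1 p2) (fun x => sz x + g1 x + g2 (f x))).
  apply: polybound_add; last exact: polybound_comp pf pg2.
  by pbound.
move=> x; have [t1 e1 l1] := H1 x; have [t2 e2 l2] := H2 (f x).
by exists (sz x + t1 + t2); [apply: Ecomp e1 e2 | rewrite -!addnA leq_add2l leq_add].
Qed.

Lemma poly_ext A B {eA : enc A} {eB : enc B} (f g : A -> B) :
  (forall x, f x = g x) -> poly f -> poly g.
Proof.
move=> E [p h ph H]; apply: Poly ph _ => x.
by rewrite -E; exact: H.
Qed.

(** Trees are untyped, so a change of type that keeps the tree costs only the identity program. In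
    this way numbers are read as digit lists, pairs as nonempty lists, and typed instances as raw
    ones. *)
Lemma poly_recode A B {eA : enc A} {eB : enc B} (f : A -> B) :
  (forall x, encode (f x) = encode x) -> poly f.
Proof.
move=> E; apply: (@Poly _ _ _ _ _ Pid (fun x => sz x)); first exact: polybound_sz.
by move=> x; rewrite E; exists (sz x) => //; exact: Eid.
Qed.

Lemma poly_id A {eA : enc A} : poly (fun x : A => x).
Proof. exact: poly_recode. Qed.

Lemma poly_const A B {eA : enc A} {eB : enc B} (c : B) : poly (fun _ : A => c).
Proof.
have [p [g [pg H]]] : exists p (g : A -> nat), polybound g /\
    forall x : A, exists2 t, eval p (encode x) (encode c) t & t <= g x; last exact: Poly pg H.
elim: (encode c) => [|l [p1 [g1 [pg1 H1]]] r [p2 [g2 [pg2 H2]]]].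
  exists Pleaf, (fun x => sz x); split; first exact: polybound_sz.
  by move=> x; exists (sz x) => //; exact: Eleaf.
exists (Ppair p1 p2), (fun x => sz x + g1 x + g2 x); split.
  pbound.
move=> x; have [t1 e1 l1] := H1 x; have [t2 e2 l2] := H2 x.
by exists (sz x + t1 + t2); [apply: Epair | rewrite -!addnA leq_add2l leq_add].
Qed.

Lemma poly_pair A B C {eA : enc A} {eB : enc B} {eC : enc C} (f : A -> B) (h : A -> C) :
  poly f -> poly h -> poly (fun x => (f x, h x)).
Proof.
move=> [p1 g1 pg1 H1] [p2 g2 pg2 H2].
apply: (@Poly _ _ _ _ _ (Ppair p1 p2) (fun x => sz x + g1 x + g2 x)).
  pbound.
move=> x; have [t1 e1 l1] := H1 x; have [t2 e2 l2] := H2 x.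
by exists (sz x + t1 + t2); [apply: Epair | rewrite -!addnA leq_add2l leq_add].
Qed.

Lemma poly_fst A B C {eA : enc A} {eB : enc B} {eC : enc C} (f : A -> B * C) :
  poly f -> poly (fun x => (f x).1).
Proof.
apply: (poly_comp (h := fst)).
apply: (@Poly _ _ _ _ _ Phead (fun x => sz x)); first exact: polybound_sz.
by move=> x; exists (sz x) => //; exact: Ehead.
Qed.

Lemma poly_snd A B C {eA : enc A} {eB : enc B} {eC : enc C} (f : A -> B * C) :
  poly f -> poly (fun x => (f x).2).
Proof.
apply: (poly_comp (h := snd)).
apply: (@Poly _ _ _ _ _ Ptail (fun x => sz x)); first exact: polybound_sz.
by move=> x; exists (sz x) => //; exact: Etail.
Qed.

Lemma poly_cons A B {eA : enc A} {eB : enc B} (f : A -> B) (l : A -> seq B) :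
  poly f -> poly l -> poly (fun x => f x :: l x).
Proof.
move=> pf pl; apply: (poly_comp (f := fun x => (f x, l x)) (h := fun p => p.1 :: p.2)).
  by apply: poly_recode; case.
exact: poly_pair.
Qed.

Lemma poly_if A B {eA : enc A} {eB : enc B} (b : A -> bool) (f h : A -> B) :
  poly b -> poly f -> poly h -> poly (fun x => if b x then f x else h x).
Proof.
move=> [p0 g0 pg0 H0] [p1 g1 pg1 H1] [p2 g2 pg2 H2].
apply: (@Poly _ _ _ _ _ (Pif p0 p1 p2) (fun x => sz x + g0 x + (g1 x + g2 x))).
  pbound.
move=> x; have [t0 e0 l0] := H0 x; have [t1 e1 l1] := H1 x.
have [t2 e2 l2] := H2 x; move: e0; case: (b x) => e0.
  exists (sz x + t0 + t1); first exact: Eif_node e0 e1.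
  by rewrite leq_add ?leq_add2l ?(leq_trans l1) ?leq_addr.
exists (sz x + t0 + t2); first exact: Eif_leaf e0 e2.
by rewrite leq_add ?leq_add2l ?(leq_trans l2) ?leq_addl.
Qed.

(** The empty list is a [Leaf] and a nonempty one a [Node], so the list itself serves as the test,
    and its tree is already the pair of its head and tail. *)
Lemma poly_seq_case A B C {eA : enc A} {eB : enc B} {eC : enc C}
    (l : A -> seq B) (f : A -> B -> seq B -> C) (h : A -> C) :
  poly l -> poly (fun p : A * (B * seq B) => f p.1 p.2.1 p.2.2) -> poly h ->
  poly (fun x => if l x is a :: s then f x a s else h x).
Proof.
move=> [p0 g0 pg0 H0] [p1 g1 [C1 [k1 pg1]] H1] [p2 g2 pg2 H2].
have pl : poly l by exact: Poly pg0 H0.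
pose (w := fun x : A => (sz x + sz (l x)).+1).
have pw : polybound w.
  have := poly_polybound pl => pl'.
  by apply: (@polybound_le _ _ _ (fun x => 1 + (sz x + sz (l x)))); first pbound.
apply: (@Poly _ _ _ _ _ (Pif p0 (Pcomp (Ppair Pid p0) p1) p2)
  (fun x => sz x + g0 x + (sz x + (sz x + sz x + g0 x) + C1 * w x ^ k1 + g2 x))).
  pbound.
move=> x; have [t0 e0 l0] := H0 x; have [t2 e2 l2] := H2 x.
have Ew : w x = sz (x, l x) by [].
move: e0 Ew; case E : (l x) => [|a s] e0 Ew.
  by exists (sz x + t0 + t2); [apply: Eif_leaf e0 e2 | lia].
have [t1 /= e1 l1] := H1 (x, (a, s)); have := leq_trans l1 (pg1 _).
rewrite (_ : sz _ = w x) // => l1'.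
exists (sz x + t0 + (sz x + (sz x + sz x + t0) + t1)); last by lia.
apply: (@Eif_node _ _ _ _ (encode a) (encode s) _ _ _ e0); apply: (Ecomp _ e1); apply: (Epair _ e0); exact: Eid.
Qed.

Lemma leq_exp2r' m n k : m <= n -> m ^ k <= n ^ k.
Proof. by move=> mn; case: k => [|k] //; rewrite leq_exp2r. Qed.

(** * Loops as left folds with bounded accumulators *)

Section Foldl.

Context {T A B : Type} {eT : enc T} {eA : enc A} {eB : enc B}.
Variables (f : T -> B -> A -> B) (b0 : T -> B) (l : T -> seq A).
Hypotheses (pf : poly (fun p : T * B * A => f p.1.1 p.1.2 p.2))
  (pb0 : poly b0) (pl : poly l).

Lemma sz_take (s : seq A) i : sz (take i s) <= sz s.
Proof. by elim: s i => [|a s IH] [|i] //; rewrite /= !sz_cons ltnS leq_add2l. Qed.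

Lemma size_sz (s : seq A) : size s < sz s.
Proof. by elim: s => [|a s IH] //; rewrite sz_cons /=; have := sz_gt0 a; lia. Qed.

(** The bound on every intermediate accumulator is what keeps polynomially many polynomial steps
    polynomial. The loop state holds the parameter, the accumulator and the remaining list; the
    latter is the tail of the state and ends the loop when it becomes [Leaf]. *)
Lemma poly_foldl_bound :
  (exists2 g : T -> nat, polybound g &
     forall t i, sz (foldl (f t) (b0 t) (take i (l t))) <= g t) ->
  poly (fun t => foldl (f t) (b0 t) (l t)).
Proof.
case=> g pg Hg; have [p h [C [k Hh]] Hp] := pf.
pose step := Ppair (Ppair (Pcomp Phead Phead)
   (Pcomp (Ppair Phead (Pcomp Ptail Phead)) p)) (Pcomp Ptail Ptail).
pose (st := fun (t : T) (b : B) (s : seq A) => ((t, b), s)).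
have step_ok M t b a s : sz (st t b (a :: s)) <= M ->
  exists2 u, eval step (encode (st t b (a :: s))) (encode (st t (f t b a) s)) u &
    u <= 20 * M + C * M ^ k.
  move=> sM; have [u1 e1 l1] := Hp (t, b, a).
  have l2 : u1 <= C * M ^ k.
    apply: leq_trans l1 (leq_trans (Hh _) _).
    rewrite leq_mul2l leq_exp2r' ?orbT //.
    by move: sM; rewrite /st !sz_pair sz_cons; lia.
  eexists.
    apply: Epair; last by apply: Ecomp; [exact: Etail | exact: Etail].
    apply: Epair; first by apply: Ecomp; [exact: Ehead | exact: Ehead].
    apply: Ecomp; last exact: e1.
    apply: Epair; first exact: Ehead.
    by apply: Ecomp; [exact: Etail | exact: Ehead].
  by move: l2 sM; rewrite /sz /encode /=; lia.
have loop M t s b : (forall i, sz (st t (foldl (f t) b (take i s)) s) <= M) ->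
  exists2 u, eval (Pwhile Ptail step) (encode (st t b s))
      (encode (st t (foldl (f t) b s) [::])) u &
    u <= (size s).+1 * (22 * M + C * M ^ k).
  elim: s b => [|a s IH] b HM.
    exists (sz (st t b [::]) + sz (st t b [::])); last first.
      by have := HM 0; rewrite take0 /=; lia.
    by apply: Ewhile_stop; exact: Etail.
  have [|u1 e1 l1] := step_ok M t b a s; first by have := HM 0.
  have [|u2 e2 l2] := IH (f t b a).
    move=> i; apply: leq_trans (HM i.+1); rewrite /st /= !sz_pair sz_cons; lia.
  exists (sz (st t b (a :: s)) + sz (st t b (a :: s)) + u1 + u2).
    by apply: Ewhile_step e1 e2; exact: Etail.
  have := HM 0; rewrite take0 /= mulSn => l0; lia.
pose (M := fun t => ((sz t + g t).+1 + sz (l t)).+1).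
have pM : polybound M.
  have := poly_polybound pl => pl'.
  apply: (@polybound_le _ _ _ (fun t => 2 + (sz t + g t) + sz (l t))); first pbound.
  by move=> t; rewrite /M; lia.
have [pi gi pgi Hi] : poly (fun t => st t (b0 t) (l t)).
  by apply: poly_pair pl; apply: poly_pair pb0; exact: poly_id.
apply: (@Poly _ _ _ _ _ (Pcomp (Pcomp pi (Pwhile Ptail step)) (Pcomp Phead Ptail))
  (fun t => sz t + (sz t + gi t + sz (l t) * (22 * M t + C * M t ^ k)) + 4 * M t)).
  have := poly_polybound pl => pl'.
  by pbound.
move=> t; have [u1 e1 l1] := Hi t.
have [|u2 e2 l2] := loop (M t) t (l t) (b0 t).
  by move=> i; rewrite /st /M !sz_pair; have := Hg t i; lia.
have ls : (size (l t)).+1 <= sz (l t).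
  exact: size_sz.
eexists.
  apply: Ecomp; first by apply: Ecomp e1 e2.
  by apply: Ecomp; [exact: Ehead | exact: Etail].
rewrite /st /=.
have := Hg t (size (l t)); rewrite take_size /M => Hg'.
have : u2 <= sz (l t) * (22 * M t + C * M t ^ k).
  by apply: leq_trans l2 _; rewrite leq_mul2r ls orbT.
move: (_ * _) => X; move: Hg' l1; rewrite /M /sz /encode /= => Hg' l1; lia.
Qed.

Lemma sz_In (s : seq A) a : List.In a s -> sz a <= sz s.
Proof.
by elim: s => [|b s IH] //= [<-|/IH]; rewrite sz_cons; lia.
Qed.

(** Increments that do not depend on the accumulator add up to at most the size of the list times a
    bound on a single increment. *)
Lemma poly_foldl_grow (g : T * A -> nat) : polybound g ->
  (forall t b a, sz (f t b a) <= sz b + g (t, a)) ->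
  poly (fun t => foldl (f t) (b0 t) (l t)).
Proof.
move=> [C [k Hg]] Hf; apply: poly_foldl_bound.
pose (w := fun t => C * (sz t + sz (l t) + 1) ^ k).
exists (fun t => sz (b0 t) + sz (l t) * w t).
  by have pl' := poly_polybound pl; have pb' := poly_polybound pb0; pbound.
move=> t i.
have [sl Hin] : size (take i (l t)) <= sz (l t) /\ forall a, List.In a (take i (l t)) -> sz a <= sz (l t).
  split; last by move=> a /sz_In; have := sz_take (l t) i; lia.
  by have := sz_take (l t) i; have := size_sz (take i (l t)); lia.
have H : sz (foldl (f t) (b0 t) (take i (l t))) <= sz (b0 t) + size (take i (l t)) * w t; last first.
  by apply: leq_trans H _; rewrite leq_add2l leq_mul2r sl orbT.
elim: (take i (l t)) (b0 t) {sl} Hin => [|a s IH] b Hin /=; first by lia.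
have {IH} := IH (f t b a) (fun c i => Hin c (or_intror i)).
have h := Hf t b a; have : g (t, a) <= w t.
  apply: leq_trans (Hg _) _; rewrite leq_mul2l leq_exp2r' ?orbT //.
  by rewrite sz_pair; have := Hin a (or_introl erefl); lia.
by lia.
Qed.

End Foldl.

Ltac is_ite b x :=
  let r := eval cbv beta in (b x) in
  lazymatch r with match _ with true => _ | false => _ end => idtac end.

Ltac poly_ite := lazymatch goal with
  | |- @poly ?A _ _ _ ?b =>
    assert_succeeds (exfalso; let x := fresh "x" in
      assert (forall x : A, b x = b x); [intro x; is_ite b x; reflexivity | ]);
    refine (poly_if _ _ _) end.

Ltac poly_user := fail.

Ltac polyt := repeat first
  [ assumption
  | match goal with
    | |- poly (fun _ => ?c) => exact (poly_const c)
    | |- poly (fun x => x) => exact poly_id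
    | |- poly fst => exact (poly_fst poly_id)
    | |- poly snd => exact (poly_snd poly_id)
    | |- poly (fun x => (@?f x, @?g x)) => apply (@poly_pair _ _ _ _ _ _ f g)
    | |- poly (fun x => fst (@?f x)) => apply (@poly_fst _ _ _ _ _ _ f)
    | |- poly (fun x => snd (@?f x)) => apply (@poly_snd _ _ _ _ _ _ f)
    | |- poly (fun x => @?f x :: @?g x) => apply (@poly_cons _ _ _ _ f g)
    end
  | progress poly_user | poly_ite ].

(** * List operations *)

Section Lists.
Context {T A : Type} {eT : enc T} {eA : enc A}.

Lemma poly_catrev (l1 l2 : T -> seq A) :
  poly l1 -> poly l2 -> poly (fun t => catrev (l1 t) (l2 t)).
Proof.
move=> p1 p2; apply: (poly_ext (f := fun t => foldl (fun acc x => x :: acc) (l2 t) (l1 t))).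
  by move=> t; elim: (l1 t) (l2 t) => //= x s IH acc; rewrite IH.
apply: (@poly_foldl_grow T A (seq A) _ _ _ (fun _ acc x => x :: acc) l2 l1 _ p2 p1
  (fun p => (sz p).+1)); first by polyt.
  by apply: (@polybound_le _ _ _ (fun p => 1 + sz p)); first pbound.
by move=> t b a; rewrite sz_cons sz_pair; lia.
Qed.

Lemma poly_rev (l : T -> seq A) : poly l -> poly (fun t => rev (l t)).
Proof. by move=> pl; apply: poly_catrev; polyt. Qed.

Lemma poly_cat (l1 l2 : T -> seq A) :
  poly l1 -> poly l2 -> poly (fun t => l1 t ++ l2 t).
Proof.
move=> p1 p2; apply: (poly_ext (f := fun t => catrev (rev (l1 t)) (l2 t))).
  by move=> t; rewrite catrevE revK.
by apply: poly_catrev => //; apply: poly_rev.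
Qed.

Lemma sz_catrev (s1 s2 : seq A) : (sz (catrev s1 s2)).+1 = sz s1 + sz s2.
Proof.
elim: s1 s2 => [|x s IH] s2 /=; first by rewrite /sz /=; lia.
by rewrite IH !sz_cons; lia.
Qed.

End Lists.

Section FlatMap.
Context {T A B : Type} {eT : enc T} {eA : enc A} {eB : enc B}.

(** Pieces are pushed in reverse onto the accumulator, so a step costs only the growth by one piece;
    a final reversal restores the order. *)
Lemma poly_flatmap (f : T -> A -> seq B) (l : T -> seq A) :
  poly (fun p : T * A => f p.1 p.2) -> poly l ->
  poly (fun t => flatten [seq f t a | a <- l t]).
Proof.
move=> pf pl.
apply: (poly_ext (f := fun t => rev (foldl (fun acc a => catrev (f t a) acc) [::] (l t)))).
  move=> t; apply: (canLR revK).
  rewrite -[RHS]cats0 -catrevE; elim: (l t) [::] => [|a s IH] acc //=.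
  by rewrite IH !catrevE rev_cat catA.
apply: poly_rev.
apply: (@poly_foldl_grow T A (seq B) _ _ _ (fun t acc a => catrev (f t a) acc)
  (fun _ => [::]) l _ _ pl (fun p => sz (f p.1 p.2))).
- apply: poly_catrev; last by polyt.
  by apply: (poly_comp (h := fun p => f p.1 p.2) (f := fun p : T * seq B * A => (p.1.1, p.2)));
    polyt.
- by polyt.
- exact: (poly_polybound pf).
- move=> t b a /=.
  by have := @sz_catrev _ eB (f t a) b; lia.
Qed.

End FlatMap.

Section MoreLists.
Context {T A B : Type} {eT : enc T} {eA : enc A} {eB : enc B}.

Lemma poly_map (f : T -> A -> B) (l : T -> seq A) :
  poly (fun p : T * A => f p.1 p.2) -> poly l ->
  poly (fun t => [seq f t a | a <- l t]).
Proof.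
move=> pf pl.
apply: (poly_ext (f := fun t => flatten [seq [:: f t a] | a <- l t])).
  by move=> t; elim: (l t) => //= a s ->.
by apply: poly_flatmap => //; polyt.
Qed.

Lemma poly_filter (f : T -> A -> bool) (l : T -> seq A) :
  poly (fun p : T * A => f p.1 p.2) -> poly l ->
  poly (fun t => [seq a <- l t | f t a]).
Proof.
move=> pf pl.
apply: (poly_ext (f := fun t => flatten [seq if f t a then [:: a] else [::] | a <- l t])).
  by move=> t; elim: (l t) => //= a s ->; case: ifP.
by apply: poly_flatmap => //; polyt.
Qed.

Lemma poly_has (f : T -> A -> bool) (l : T -> seq A) :
  poly (fun p : T * A => f p.1 p.2) -> poly l -> poly (fun t => has (f t) (l t)).
Proof.
move=> pf pl.
apply: (poly_ext (f := fun t => foldl (fun b a => if b then true else f t a) false (l t))).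
  move=> t; rewrite -[RHS]/(false || has (f t) (l t)).
  by elim: (l t) false => [|a s IH] b /=; rewrite ?orbF // IH orbA; case: b.
apply: (@poly_foldl_grow T A bool _ _ _ (fun t b a => if b then true else f t a)
  (fun _ => false) l _ _ pl (fun _ => 3)); polyt.
- by apply: (poly_comp (h := fun p => f p.1 p.2) (f := fun p : T * bool * A => (p.1.1, p.2)));
    polyt.
- exact: polybound_const.
- by move=> t b a; case: b; case: (f t a).
Qed.

Lemma poly_zip (l1 : T -> seq A) (l2 : T -> seq B) :
  poly l1 -> poly l2 -> poly (fun t => zip (l1 t) (l2 t)).
Proof.
move=> p1 p2.
pose (step := fun (st : seq B * seq (A * B)) (a : A) =>
  if st.1 is b :: s then (s, (a, b) :: st.2) else st).
apply: (poly_ext (f := fun t => rev (foldl step (l2 t, [::]) (l1 t)).2)).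
  move=> t; apply: (canLR revK); rewrite -[RHS]cats0 -catrevE.
  elim: (l1 t) (l2 t) [::] => [|a s IH] [|b s'] acc //=; rewrite -?IH //=.
  by elim: s {IH}.
apply: poly_rev; apply: poly_snd.
apply: (@poly_foldl_grow T A _ _ _ _ (fun _ => step) (fun t => (l2 t, [::])) l1 _ _ p1
  (fun p => (sz p.2).+1)); polyt.
- apply: (poly_seq_case (l := fun p : T * (seq B * seq (A * B)) * A => p.1.2.1)
    (f := fun p b s => (s, (p.2, b) :: p.1.2.2)) (h := fun p => p.1.2)); polyt.
- apply: (@polybound_le _ _ _ (fun p => 1 + sz p)); first pbound.
  by move=> [t a]; rewrite sz_pair /=; lia.
- by move=> t [[|b s] acc] a /=; rewrite /step !sz_pair /= ?sz_cons ?sz_pair; lia.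
Qed.

End MoreLists.

Ltac poly_seq :=
  match goal with
  | |- poly (fun x => @?f x ++ @?g x) => apply (@poly_cat _ _ _ _ f g)
  | |- poly (fun x => rev (@?f x)) => apply (@poly_rev _ _ _ _ f)
  | |- poly (fun x => map (@?f x) (@?l x)) =>
      apply (@poly_map _ _ _ _ _ _ f l); cbv beta
  | |- poly (fun x => flatten (map (@?f x) (@?l x))) =>
      apply (@poly_flatmap _ _ _ _ _ _ f l); cbv beta
  | |- poly (fun x => filter (@?f x) (@?l x)) =>
      apply (@poly_filter _ _ _ _ f l); cbv beta
  | |- poly (fun x => has (@?f x) (@?l x)) =>
      apply (@poly_has _ _ _ _ f l); cbv beta
  | |- poly (fun x => zip (@?f x) (@?g x)) => apply (@poly_zip _ _ _ _ _ _ f g)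
  end.

Ltac poly_user ::= poly_seq.

Lemma poly_negb T {eT : enc T} (b : T -> bool) : poly b -> poly (fun t => ~~ b t).
Proof.
move=> pb; apply: (poly_ext (f := fun t => if b t then false else true)); last by polyt.
by move=> t; case: (b t).
Qed.

Lemma poly_andb T {eT : enc T} (b c : T -> bool) :
  poly b -> poly c -> poly (fun t => b t && c t).
Proof.
move=> pb pc; apply: (poly_ext (f := fun t => if b t then c t else false)); last by polyt.
by move=> t; case: (b t).
Qed.

(** * Binary arithmetic *)

Definition bitval (s : seq bool) : nat := foldr (fun (b : bool) n => b + n.*2) 0 s.

(** Zero has the empty digit list, so a canonical list has no [false] at its top end; a zero digit
    above which nothing stands is dropped. *)
Definition bcons (b : bool) (s : seq bool) := if b || ~~ nilp s then b :: s else [::].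

Definition norm (s : seq bool) := foldr bcons [::] s.

Lemma nat_bits_step (b : bool) n : nat_bits (b + n.*2) = bcons b (nat_bits n).
Proof.
have E : N.of_nat (b + n.*2) = if b then N.succ_double (N.of_nat n) else N.double (N.of_nat n).
  by case: b; lia.
rewrite /nat_bits E /bcons; case: (N.of_nat n) => [|p]; case: b {E} => //=; by case: p.
Qed.

Lemma nat_bits_bitval s : nat_bits (bitval s) = norm s.
Proof. by elim: s => [|b s IH] //=; rewrite nat_bits_step IH. Qed.

Lemma bitval_nat_bits n : bitval (nat_bits n) = n.
Proof.
elim/ltn_ind: n => n IH; case: (posnP n) => [->//|n0].
have E : n = odd n + n./2.*2 by rewrite odd_double_half.
have n2 : n./2 < n by lia.
rewrite {1}E nat_bits_step /bcons; case: ifP => [_|] /=; first by rewrite IH.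
have := IH _ n2; case: (nat_bits _) => [/=|//]; case: (odd n) E => //= ->; lia.
Qed.

Lemma size_bits_le n k : (size (nat_bits n) <= k) = (n < 2 ^ k).
Proof.
elim: k n => [|k IH] n.
  rewrite leqn0 -/(nilp _) expn0 ltnS leqn0; apply/nilP/eqP => [E|->//].
  by rewrite -(bitval_nat_bits n) E.
have E : n = odd n + n./2.*2 by rewrite odd_double_half.
rewrite {1}E nat_bits_step /bcons; case: ifP => [_|] /=.
  by rewrite ltnS IH expnS; lia.
move=> H; have : n./2 = 0.
  by rewrite -(bitval_nat_bits n./2); move: H; case: (nat_bits _); case: (odd n).
have := expn_gt0 2 k; rewrite expnS; case: (odd n) H E => //= _ E; lia.
Qed.

(** A digit costs at most three for its Boolean and one for its list node. *)
Lemma sz_nat_le n k : n < 2 ^ k -> sz n <= 4 * k + 1.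
Proof.
rewrite -size_bits_le; set s := nat_bits n; have -> : sz n = sz s by [].
elim: s k => [|b s IH] k /=; first by rewrite /sz /=; lia.
case: k => // k /IH; rewrite sz_cons; have : sz b <= 3 by case: b.
lia.
Qed.

Lemma nat_lt_sz n : n < 2 ^ sz n.
Proof.
rewrite -size_bits_le; have -> : sz n = sz (nat_bits n) by [].
exact: ltnW (size_sz _).
Qed.

Lemma poly_bits T {eT : enc T} (f : T -> nat) : poly f -> poly (fun t => nat_bits (f t)).
Proof. by apply: (poly_comp (h := nat_bits)); exact: poly_recode. Qed.

Lemma poly_of_bits T {eT : enc T} (f : T -> nat) (s : T -> seq bool) :
  (forall t, bitval (s t) = f t) -> poly s -> poly f.
Proof.
move=> E ps; have pn : poly (fun t => norm (s t)).
  apply: (poly_ext (f := fun t => foldl (fun acc b => bcons b acc) [::] (rev (s t)))).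
    by move=> t; rewrite foldl_rev.
  have pc : poly (fun p : T * seq bool * bool => bcons p.2 p.1.2).
    apply: (poly_ext (f := fun p : T * seq bool * bool =>
      if p.2 then p.2 :: p.1.2 else if p.1.2 is _ :: _ then p.2 :: p.1.2 else [::])).
      by move=> [[t s0] b] /=; rewrite /bcons; case: b; case: s0.
    polyt; apply: (@poly_seq_case _ _ _ _ _ _ (fun p : T * seq bool * bool => p.1.2)
      (fun p _ _ => p.2 :: p.1.2) (fun _ => [::])); polyt.
  apply: (@poly_foldl_grow _ _ _ _ _ _ (fun _ acc b => bcons b acc) (fun _ => [::])
    (fun t => rev (s t)) pc _ _ (fun _ => 4)); polyt.
  - exact: polybound_const.
  - move=> t b a; rewrite /bcons; case: ifP => _; last by have := sz_gt0 b; rewrite /sz /=; lia.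
    by rewrite sz_cons; case: a; rewrite /sz /=; lia.
case: pn => p g pg H; apply: (Poly (p := p) pg) => t.
have -> : encode (f t) = encode (norm (s t)) by rewrite -E -nat_bits_bitval.
exact: H.
Qed.

(** * Ripple-carry addition and subtraction *)

Definition maj (c x y : bool) := if x then y || c else y && c.
Definition borrow (c x y : bool) := if x then y && c else y || c.

Section Ripple.
Variable carry : bool -> bool -> bool -> bool.

(** Addition and subtraction have the same result digit, the exclusive or of the three inputs; they
    differ only in the rule for the carry. *)
Fixpoint ripple (c : bool) (l : seq (bool * bool)) : seq bool * bool :=
  if l is xy :: l' then
    let r := ripple (carry c xy.1 xy.2) l' in ((xy.1 (+) xy.2 (+) c) :: r.1, r.2)
  else ([::], c).

Lemma size_ripple c l : size (ripple c l).1 = size l.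
Proof. by elim: l c => //= xy l IH c; rewrite IH. Qed.

Lemma poly_ripple T {eT : enc T} (l : T -> seq (bool * bool)) :
  poly l -> poly (fun t => ripple false (l t)).
Proof.
move=> pl.
pose (step := fun (st : seq bool * bool) (xy : bool * bool) =>
  ((xy.1 (+) xy.2 (+) st.2) :: st.1, carry st.2 xy.1 xy.2)).
have E b acc s : foldl step (acc, b) s = (catrev (ripple b s).1 acc, (ripple b s).2).
  by elim: s b acc => //= xy s IH b acc; rewrite IH.
apply: (poly_ext (f := fun t => (rev (foldl step ([::], false) (l t)).1, (foldl step ([::], false) (l t)).2))).
  by move=> t /=; rewrite E catrevE cats0 revK /= -surjective_pairing.
have ptab (f : bool -> bool -> bool -> bool) U (eU : enc U) (x y z : U -> bool) :
    poly x -> poly y -> poly z -> poly (fun u => f (x u) (y u) (z u)).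
  move=> px py pz.
  apply: (poly_ext (f := fun u => if x u then if y u then if z u then f true true true
    else f true true false else if z u then f true false true else f true false false
    else if y u then if z u then f false true true
    else f false true false else if z u then f false false true else f false false false)).
    by move=> u; case: (x u); case: (y u); case: (z u).
  by polyt.
have pf : poly (fun t => foldl step ([::], false) (l t)); last first.
  by polyt.
have ps : poly (fun p : T * (seq bool * bool) * (bool * bool) => step p.1.2 p.2).
  apply: poly_pair; last by apply: ptab; polyt.
  apply: poly_cons; last by polyt.
  by apply: (ptab (fun a b c => a (+) b (+) c)); polyt.
apply: (@poly_foldl_grow _ _ _ _ _ _ (fun _ => step) (fun _ => ([::], false))
    l ps _ _ (fun _ => 10)); polyt.
- exact: polybound_const.
- move=> t [acc b] xy; rewrite /step !sz_pair /= !sz_cons.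
  by case: (_ (+) _); case: (carry _ _ _); case: b; rewrite /sz /=; lia.
Qed.

End Ripple.

Lemma ripple_add c l :
  bitval (ripple maj c l).1 + (ripple maj c l).2 * 2 ^ size l =
  bitval (unzip1 l) + bitval (unzip2 l) + c.
Proof.
elim: l c => [|[x y] l IH] c /=; first by lia.
by have := IH (maj c x y); rewrite /= expnS; case: x; case: y; case: c => /=; lia.
Qed.

Lemma ripple_sub c l :
  bitval (ripple borrow c l).1 + bitval (unzip2 l) + c =
  bitval (unzip1 l) + (ripple borrow c l).2 * 2 ^ size l.
Proof.
elim: l c => [|[x y] l IH] c /=; first by lia.
by have := IH (borrow c x y); rewrite /= expnS; case: x; case: y; case: c => /=; lia.
Qed.

Lemma bitval_lt s : bitval s < 2 ^ size s.
Proof. by elim: s => //= b s IH; rewrite expnS; case: b; lia. Qed.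

(** Each list receives as many zeros as the other has digits, so the lengths agree and [zip] loses
    nothing. *)
Definition padzip (s1 s2 : seq bool) :=
  zip (s1 ++ [seq false | _ <- s2]) (s2 ++ [seq false | _ <- s1]).

Lemma bitval_pad (s : seq bool) (s' : seq bool) : bitval (s ++ [seq false | _ <- s']) = bitval s.
Proof.
elim: s => [|b s IH] /=; last by rewrite IH.
by elim: s' => //= _ s ->.
Qed.

Lemma padzip1 s1 s2 : bitval (unzip1 (padzip s1 s2)) = bitval s1.
Proof. by rewrite unzip1_zip ?bitval_pad // !size_cat !size_map addnC. Qed.

Lemma padzip2 s1 s2 : bitval (unzip2 (padzip s1 s2)) = bitval s2.
Proof. by rewrite unzip2_zip ?bitval_pad // !size_cat !size_map addnC. Qed.

Section Arith.
Context {T : Type} {eT : enc T}.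
Implicit Types f g : T -> nat.

Lemma poly_padzip f g : poly f -> poly g -> poly (fun t => padzip (nat_bits (f t)) (nat_bits (g t))).
Proof.
move=> pf pg; have pf' := poly_bits pf; have pg' := poly_bits pg.
by rewrite /padzip; polyt.
Qed.

Lemma poly_addn f g : poly f -> poly g -> poly (fun t => f t + g t).
Proof.
move=> pf pg; pose (r := fun t => ripple maj false (padzip (nat_bits (f t)) (nat_bits (g t)))).
have pr : poly r by apply: poly_ripple; exact: poly_padzip.
apply: (poly_of_bits (s := fun t => (r t).1 ++ [:: (r t).2])); last by polyt.
move=> t; have := ripple_add false (padzip (nat_bits (f t)) (nat_bits (g t))).
rewrite padzip1 padzip2 !bitval_nat_bits addn0 => <-.
rewrite -/(r t) -(size_ripple maj false) -/(r t).
by elim: (r t).1 => [|b s IH] /=; rewrite ?IH ?expnS; lia.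
Qed.

(** The result digits and [m] are both worth less than [2 ^ size], so in [ripple_sub] the last
    borrow decides the comparison; if it is clear, the same run gives the difference. *)
Lemma ripple_borrow m n :
  (ripple borrow false (padzip (nat_bits m) (nat_bits n))).2 = (m < n) /\
  (n <= m -> bitval (ripple borrow false (padzip (nat_bits m) (nat_bits n))).1 = m - n).
Proof.
have := ripple_sub false (padzip (nat_bits m) (nat_bits n)).
have := bitval_lt (ripple borrow false (padzip (nat_bits m) (nat_bits n))).1.
rewrite size_ripple padzip1 padzip2 !bitval_nat_bits addn0.
have := bitval_lt (unzip1 (padzip (nat_bits m) (nat_bits n))).
rewrite padzip1 bitval_nat_bits size_map.
by case: (ripple _ _ _) => r [] /=; lia.
Qed.

Lemma poly_ltn f g : poly f -> poly g -> poly (fun t => f t < g t).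
Proof.
move=> pf pg.
apply: (poly_ext (f := fun t => (ripple borrow false (padzip (nat_bits (f t)) (nat_bits (g t)))).2)).
  by move=> t; have [-> _] := ripple_borrow (f t) (g t).
by apply: poly_snd; apply: poly_ripple; exact: poly_padzip.
Qed.

Lemma poly_leq f g : poly f -> poly g -> poly (fun t => f t <= g t).
Proof.
move=> pf pg; apply: (poly_ext (f := fun t => ~~ (g t < f t))); first by move=> t; rewrite -leqNgt.
by apply: poly_negb; exact: poly_ltn.
Qed.

Lemma poly_minn f g : poly f -> poly g -> poly (fun t => minn (f t) (g t)).
Proof. by move=> pf pg; rewrite /minn; have := poly_ltn pf pg => pl; polyt. Qed.

Lemma poly_subn f g : poly f -> poly g -> poly (fun t => f t - g t).
Proof.
move=> pf pg.
apply: (poly_of_bits (s := fun t => if f t <= g t then [::] else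
  (ripple borrow false (padzip (nat_bits (f t)) (nat_bits (g t)))).1)).
  move=> t; case: leqP => [|/ltnW] le; first by rewrite (eqnP le).
  by have [_ ->] := ripple_borrow (f t) (g t).
have := poly_leq pf pg => pl; polyt.
by apply: poly_ripple; exact: poly_padzip.
Qed.

End Arith.

(** Horner's scheme from the top digit. After [i] digits the accumulator is at most [2 ^ i] times
    the second factor, which bounds its length. *)
Lemma poly_muln T {eT : enc T} (f g : T -> nat) :
  poly f -> poly g -> poly (fun t => f t * g t).
Proof.
move=> pf pg.
apply: (poly_ext (f := fun t =>
   foldl (fun acc b => acc + acc + (if b then g t else 0)) 0 (rev (nat_bits (f t))))).
  move=> t; rewrite foldl_rev -{2}(bitval_nat_bits (f t)).
  by elim: (nat_bits _) => //= b s ->; case: b; lia.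
have pg2 : poly (fun p : T * nat * bool => g p.1.1).
  by apply: (poly_comp (h := g)); polyt.
have pc : poly (fun p : T * nat * bool => p.1.2 + p.1.2 + (if p.2 then g p.1.1 else 0)).
  by do 2?apply: poly_addn; polyt.
apply: (@poly_foldl_bound _ _ _ _ _ _ (fun t acc b => acc + acc + (if b then g t else 0))
  (fun _ => 0) (fun t => rev (nat_bits (f t))) pc); polyt.
- exact: poly_bits.
- have pf' := poly_bits pf; have pr := poly_rev pf'.
  have pr' := poly_polybound pr; have pg' := poly_polybound pg.
  exists (fun t => 4 * (sz (rev (nat_bits (f t))) + sz (g t)) + 1); first by pbound.
  move=> t i; apply: sz_nat_le.
  set s := take _ _.
  have h1 : size s < sz s by exact: size_sz.
  have h2 : sz s <= sz (rev (nat_bits (f t))) by exact: sz_take.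
  apply: (@leq_ltn_trans (2 ^ size s * g t)).
    have H acc : foldl (fun acc (b : bool) => acc + acc + (if b then g t else 0)) acc s + g t
        <= 2 ^ size s * (acc + g t).
      elim: s acc {h1 h2} => [|b s IH] acc /=; first by rewrite mul1n.
      by apply: leq_trans (IH _) _; rewrite expnS; case: b; nia.
    by have := H 0; lia.
  have le : 2 ^ size s <= 2 ^ sz (rev (nat_bits (f t))).
    by rewrite leq_exp2l //; apply: leq_trans (ltnW h1) h2.
  apply: (leq_ltn_trans (leq_mul le (leqnn _))).
  by rewrite expnD ltn_mul2l nat_lt_sz expn_gt0.
Qed.

Lemma poly_succ T {eT : enc T} (f : T -> nat) : poly f -> poly (fun t => (f t).+1).
Proof.
move=> pf; apply: (poly_ext (f := fun t => f t + 1)); first by move=> t; rewrite addn1.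
by apply: poly_addn; polyt.
Qed.

Lemma sz_nat_lin n : sz n <= 4 * n + 1.
Proof. by apply: sz_nat_le; exact: ltn_expl. Qed.

Lemma sz_seq_nat (s : seq nat) n : all (fun m => m <= n) s -> sz s <= size s * (4 * n + 2) + 1.
Proof.
elim: s => [|m s IH] //= /andP [mn /IH]; rewrite sz_cons.
by have := sz_nat_lin m; lia.
Qed.

Section SizeIota.
Context {T A : Type} {eT : enc T} {eA : enc A}.
Variable l : T -> seq A.
Hypothesis pl : poly l.

(** Ranges are built along an existing list only: [iota 0 m] for a binary number [m] can be
    exponentially long. *)
Lemma poly_size_iota : poly (fun t => (size (l t), iota 0 (size (l t)))).
Proof.
pose (step := fun (st : nat * seq nat) (_ : A) => (st.1.+1, st.1 :: st.2)).
have E (s : seq A) : foldl step (0, [::]) s = (size s, rev (iota 0 (size s))).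
  elim/last_ind: s => [|s x IH] //=; rewrite -cats1 foldl_cat IH /= size_cat addn1.
  by rewrite /step -[in RHS](addn1 (size s)) iotaD rev_cat addn1.
have pf : poly (fun t => foldl step (0, [::]) (l t)).
  have ps : poly (fun p : T * (nat * seq nat) * A => step p.1.2 p.2).
    by rewrite /step; polyt; apply: poly_succ; polyt.
  apply: (@poly_foldl_bound _ _ _ _ _ _ (fun _ => step) (fun _ => (0, [::])) l ps); polyt.
  - exists (fun t => 7 * (sz (l t) + 1) * (sz (l t) + 1)).
      by have pl' := poly_polybound pl; pbound.
    move=> t i; rewrite E.
    have h1 : size (take i (l t)) < sz (take i (l t)) by exact: size_sz.
    have h2 : sz (take i (l t)) <= sz (l t) by exact: sz_take.
    have h3 k : sz (rev (iota 0 k)) <= size (rev (iota 0 k)) * (4 * k + 2) + 1.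
      by apply: sz_seq_nat; apply/allP => x; rewrite mem_rev mem_iota; lia.
    rewrite sz_pair; have := h3 (size (take i (l t))); rewrite size_rev size_iota.
    have := sz_nat_lin (size (take i (l t))).
    nia.
apply: (poly_ext (f := fun t => ((foldl step (0, [::]) (l t)).1, rev (foldl step (0, [::]) (l t)).2))).
  by move=> t; rewrite E revK.
by polyt.
Qed.

Lemma poly_size : poly (fun t => size (l t)).
Proof. exact: (poly_fst poly_size_iota). Qed.

Lemma poly_iota : poly (fun t => iota 0 (size (l t))).
Proof. exact: (poly_snd poly_size_iota). Qed.

End SizeIota.

Lemma foldl_sumn (s : seq nat) : foldl (fun a b => a + b) 0 s = sumn s.
Proof.
rewrite -[RHS]add0n; elim: s 0 => [|x s IH] acc /=; first by rewrite addn0.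
by rewrite IH addnA.
Qed.

Lemma poly_sumn T {eT : enc T} (l : T -> seq nat) : poly l -> poly (fun t => sumn (l t)).
Proof.
move=> pl; apply: (poly_ext (f := fun t => foldl (fun a b => a + b) 0 (l t))).
  by move=> t; rewrite foldl_sumn.
have pa : poly (fun p : T * nat * nat => p.1.2 + p.2) by apply: poly_addn; polyt.
apply: (@poly_foldl_bound _ _ _ _ _ _ (fun _ a b => a + b) (fun _ => 0) l pa); polyt.
exists (fun t => 4 * sz (l t) + 1); first by have pl' := poly_polybound pl; pbound.
move=> t i; apply: sz_nat_le.
have h2 : sz (take i (l t)) <= sz (l t) by exact: sz_take.
apply: (@leq_trans (2 ^ sz (take i (l t)))); last by rewrite leq_exp2l.
rewrite foldl_sumn; elim: (take i (l t)) => [|a s IH] //=.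
have h := nat_lt_sz a; have e : sz (a :: s) = (sz a + sz s).+1 by rewrite sz_cons.
have := expn_gt0 2 (sz a); have := expn_gt0 2 (sz s).
by rewrite e expnS expnD; nia.
Qed.

Class polyeq (A : eqType) {eA : enc A} := polyeqP : poly (fun p : A * A => p.1 == p.2).
Arguments polyeq A {eA}.

#[export] Instance polyeq_nat : polyeq nat.
Proof.
apply: (poly_ext (f := fun p : nat * nat => (p.1 <= p.2) && (p.2 <= p.1))).
  by move=> p; rewrite eqn_leq.
by apply: poly_andb; apply: poly_leq; polyt.
Qed.

#[export] Instance polyeq_bool : polyeq bool.
Proof.
apply: (poly_ext (f := fun p : bool * bool => if p.1 then p.2 else ~~ p.2)).
  by case=> [] [] [].
by polyt; apply: poly_negb; polyt.
Qed.

Lemma poly_eq T {eT : enc T} (A : eqType) {eA : enc A} {pA : polyeq A} (f g : T -> A) :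
  poly f -> poly g -> poly (fun t => f t == g t).
Proof.
move=> pf pg; apply: (poly_comp (h := fun p : A * A => p.1 == p.2) (f := fun t => (f t, g t))).
  exact: polyeqP.
by polyt.
Qed.

#[export] Instance polyeq_prod (A B : eqType) {eA : enc A} {eB : enc B}
  {pA : polyeq A} {pB : polyeq B} : polyeq (A * B)%type.
Proof. by apply: poly_andb; apply: poly_eq; polyt. Qed.

Lemma poly_mem T {eT : enc T} (A : eqType) {eA : enc A} {pA : polyeq A}
    (f : T -> A) (l : T -> seq A) :
  poly f -> poly l -> poly (fun t => f t \in l t).
Proof.
move=> pf pl; apply: (poly_ext (f := fun t => has (fun x => f t == x) (l t))).
  by move=> t; rewrite -has_pred1; apply: eq_has => x /=; rewrite eq_sym.
apply: (poly_has (f := fun t x => f t == x)) => //; apply: poly_eq; polyt.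
by apply: (poly_comp (h := f)); polyt.
Qed.

Lemma poly_call T {eT : enc T} A B {eA : enc A} {eB : enc B} (h : A -> B) (f : T -> A) :
  poly h -> poly f -> poly (fun t => h (f t)).
Proof. exact: poly_comp. Qed.

Ltac poly_arith :=
  match goal with
  | |- poly (fun x => ~~ @?f x) => apply (@poly_negb _ _ f)
  | |- poly (fun x => @?f x && @?g x) => apply (@poly_andb _ _ f g)
  | |- poly (fun x => @?f x == @?g x) => apply (@poly_eq _ _ _ _ _ f g)
  | |- poly (fun x => leq (S (@?f x)) (@?g x)) => apply (@poly_ltn _ _ f g)
  | |- poly (fun x => leq (@?f x) (@?g x)) => apply (@poly_leq _ _ f g)
  | |- poly (fun x => S (@?f x)) => apply (@poly_succ _ _ f)
  | |- poly (fun x => addn (@?f x) (@?g x)) => apply (@poly_addn _ _ f g)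
  | |- poly (fun x => subn (@?f x) (@?g x)) => apply (@poly_subn _ _ f g)
  | |- poly (fun x => muln (@?f x) (@?g x)) => apply (@poly_muln _ _ f g)
  | |- poly (fun x => minn (@?f x) (@?g x)) => apply (@poly_minn _ _ f g)
  | |- poly (fun x => iota 0 (size (@?l x))) => apply (@poly_iota _ _ _ _ l)
  | |- poly (fun x => size (@?l x)) => apply (@poly_size _ _ _ _ l)
  | |- poly (fun x => sumn (@?l x)) => apply (@poly_sumn _ _ l)
  | |- poly (fun x => in_mem (@?f x) (mem (@?l x))) => apply (@poly_mem _ _ _ _ _ f l)
  end.

Ltac poly_user ::= first [poly_seq | poly_arith].

(** * The greedy algorithm *)

(** One side of a split vertex: [false] is the side at which edges enter, [true] the side from which
    they leave. *)
Notation node := (nat * bool)%type.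
Notation arc := (node * node)%type.

(** A single copy of [e] is reversed, since parallel arcs are separate units of capacity. *)
Definition swap (e : arc) (R : seq arc) : seq arc :=
  if [seq x <- R | x == e] is _ :: r then ((e.2, e.1) :: r) ++ [seq x <- R | x != e] else R.

Definition reached (s : node) (vis : seq arc) : seq node := s :: [seq e.2 | e <- vis].

Definition frontier (s : node) (R vis : seq arc) : seq arc :=
  [seq e <- R | (e.1 \in reached s vis) && ~~ (e.2 \in reached s vis)].

(* A search tree is the list of its arcs, newest first, so that the tail of each
   arc is reached by the arcs after it. *)
Definition grow (s : node) (R vis : seq arc) : seq arc :=
  if frontier s R vis is e :: _ then e :: vis else vis.

(** The folded list is only a clock. Its extra entry gives one round more than [R] has arcs, so the
    rounds cannot all add an arc, and the search has stalled by the end. *)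
Definition search (s : node) (R : seq arc) : seq arc :=
  foldl (fun vis _ => grow s R vis) [::] ((s, s) :: R).

(* Since the search tree is listed newest first, a single pass over it walks back
   from [t] to the root, reversing the arcs of the path. *)
Definition trace1 (st : node * seq arc) (e : arc) : node * seq arc :=
  if e.2 == st.1 then (e.1, swap e st.2) else st.

Definition trace (t : node) (R vis : seq arc) : node * seq arc := foldl trace1 (t, R) vis.

Definition augment (s t : node) (st : seq arc * seq bool) : seq arc * seq bool :=
  if t \in [seq e.2 | e <- search s st.1]
  then ((trace t st.1 (search s st.1)).2, true :: st.2) else st.

(** At most [size R] augmentations are possible, each lowering the cut of the source alone. They are
    counted in unary, so that a round visibly adds a constant to the size of the state. *)
Definition maxflow (s t : node) (R : seq arc) : nat :=
  size (foldl (fun st _ => augment s t st) (R, [::]) R).2.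

Notation demand := (arc * nat)%type.

Definition coverage (D : seq demand) (R : seq arc) : nat :=
  sumn [seq minn d.2 (maxflow d.1.1 d.1.2 R) | d <- D].

(** An index, the arcs that the item buys, and its cost as numerator and denominator. *)
Notation item := (nat * (seq arc * (nat * nat)))%type.
Notation network := (seq arc * seq demand)%type.

Definition cov (N : network) (A : seq item) : nat :=
  coverage N.2 (N.1 ++ flatten [seq x.2.1 | x <- A]).

Definition cands (N : network) (items A : seq item) : seq item :=
  [seq x <- items | ~~ (x.1 \in [seq y.1 | y <- A]) && (cov N A < cov N (x :: A))].

(** Costs per unit of gain, compared by cross-multiplication in order to stay within natural
    numbers. *)
Definition better (N : network) (A : seq item) (x y : item) : bool :=
  x.2.2.1 * y.2.2.2 * (cov N (y :: A) - cov N A) <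
  y.2.2.1 * x.2.2.2 * (cov N (x :: A) - cov N A).

Definition pick1 (N : network) (A b : seq item) (x : item) : seq item :=
  if b is y :: _ then if better N A x y then [:: x] else b else [:: x].

Definition pick (N : network) (items A : seq item) : seq item :=
  foldl (pick1 N A) [::] (cands N items A).

(** Again the folded list is a clock: a round adds a new item as long as some candidate exists. *)
Definition greedy (N : network) (items : seq item) : seq item :=
  foldl (fun A _ => pick N items A ++ A) [::] items.

(** * Polynomial running time of the greedy algorithm *)

Lemma sz_seqE A {eA : enc A} (s : seq A) : sz s = (\sum_(x <- s) (sz x).+1).+1.
Proof. by elim: s => [|x s IH]; rewrite ?big_nil // big_cons sz_cons IH; lia. Qed.

Lemma sz_mem (A : eqType) {eA : enc A} (x : A) (s : seq A) : x \in s -> sz x < sz s.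
Proof.
elim: s => [|y s IH] //; rewrite inE sz_cons => /orP [/eqP -> |/IH]; lia.
Qed.

Lemma swap_perm (e : arc) (R : seq arc) : e \in R ->
  exists2 r, perm_eq R (e :: r) & perm_eq (swap e R) ((e.2, e.1) :: r).
Proof.
move=> eR; have : e \in [seq x <- R | x == e] by rewrite mem_filter eqxx.
rewrite /swap; case E : [seq x <- R | x == e] => [//|x r] _.
exists (r ++ [seq x <- R | x != e]) => //.
have : x \in [seq x <- R | x == e] by rewrite E mem_head.
rewrite mem_filter => /andP [/eqP xe _].
by rewrite -(perm_filterC (fun x => x == e) R) E xe.
Qed.

(** Reversal exchanges the two halves of a pair, so residual graphs never outgrow the original
    encoding, however many paths are reversed. *)
Lemma sz_swap e R : sz (swap e R) = sz R.
Proof.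
have [|eR] := boolP (e \in R); last first.
  rewrite /swap; case E : [seq x <- R | x == e] => [//|x r].
  have : x \in [seq x <- R | x == e] by rewrite E mem_head.
  by rewrite mem_filter => /andP [/eqP ->]; rewrite (negbTE eR).
case/swap_perm => r p1 p2; rewrite !sz_seqE (perm_big _ p1) (perm_big _ p2) /= !big_cons.
by case: e {p1 p2} => x y; rewrite /= !(sz_pair (A := node)); lia.
Qed.

Lemma poly_swap T {eT : enc T} (e : T -> arc) (R : T -> seq arc) :
  poly e -> poly R -> poly (fun t => swap (e t) (R t)).
Proof.
move=> pe pR; apply: (poly_call (h := fun p : arc * seq arc => swap p.1 p.2)
  (f := fun t => (e t, R t))); last by polyt.
apply: (poly_seq_case (l := fun p : arc * seq arc => [seq x <- p.2 | x == p.1])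
   (f := fun p _ r => ((p.1.2, p.1.1) :: r) ++ [seq x <- p.2 | x != p.1])); polyt.
Qed.

Lemma frontier_mem s R vis e : e \in frontier s R vis -> e \in R.
Proof. by rewrite mem_filter => /andP []. Qed.

Lemma poly_search T {eT : enc T} (s : T -> node) (R : T -> seq arc) :
  poly s -> poly R -> poly (fun t => search (s t) (R t)).
Proof.
move=> ps pR; apply: (poly_call (h := fun p : node * seq arc => search p.1 p.2)
  (f := fun t => (s t, R t))); last by polyt.
have pg : poly (fun p : node * seq arc * seq arc * arc => grow p.1.1.1 p.1.1.2 p.1.2).
  apply: (poly_seq_case
    (l := fun p : node * seq arc * seq arc * arc => frontier p.1.1.1 p.1.1.2 p.1.2)
    (f := fun p e _ => e :: p.1.2) (h := fun p => p.1.2)); rewrite /frontier /reached; polyt.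
apply: (@poly_foldl_grow _ _ _ _ _ _ (fun (p : node * seq arc) vis _ => grow p.1 p.2 vis)
  (fun _ => [::]) (fun p => (p.1, p.1) :: p.2) pg _ _ (fun p => sz p)); polyt.
  exact: polybound_sz.
move=> [s0 R0] vis a; rewrite /grow /=.
case E : (frontier s0 R0 vis) => [|e r]; first by lia.
have eR : e \in R0 by apply: (frontier_mem (s := s0) (vis := vis)); rewrite E mem_head.
have : sz e < sz R0 by exact: sz_mem.
by rewrite sz_cons !sz_pair; lia.
Qed.

Lemma sz_trace t R vis : sz (trace t R vis).2 = sz R.
Proof.
rewrite /trace; elim: vis t R => [|e vis IH] t R //=.
by rewrite /trace1 /=; case: ifP => _; rewrite IH // sz_swap.
Qed.

Lemma poly_trace T {eT : enc T} (s : T -> node) (R vis : T -> seq arc) :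
  poly s -> poly R -> poly vis -> poly (fun t => trace (s t) (R t) (vis t)).
Proof.
move=> ps pR pv.
have pt : poly (fun p : T * (node * seq arc) * arc => trace1 p.1.2 p.2).
  by rewrite /trace1; polyt; apply: poly_swap; polyt.
apply: (@poly_foldl_grow _ _ _ _ _ _ (fun _ => trace1) (fun t => (s t, R t)) vis pt _ _
  (fun p => sz p)); polyt.
  exact: polybound_sz.
move=> t [x R0] [y z]; rewrite /trace1 /=; case: ifP => _; last by lia.
by rewrite !sz_pair sz_swap; lia.
Qed.

Lemma poly_maxflow T {eT : enc T} (s t : T -> node) (R : T -> seq arc) :
  poly s -> poly t -> poly R -> poly (fun x => maxflow (s x) (t x) (R x)).
Proof.
move=> ps pt pR; apply: (poly_call (h := fun p : node * node * seq arc => maxflow p.1.1 p.1.2 p.2)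
  (f := fun x => (s x, t x, R x))); last by polyt.
have pa : poly (fun p : node * node * seq arc * (seq arc * seq bool) * arc =>
    augment p.1.1.1.1 p.1.1.1.2 p.1.2).
  rewrite /augment; polyt; try (by apply: poly_search; polyt).
  by apply: poly_trace; polyt; apply: poly_search; polyt.
rewrite /maxflow; polyt.
apply: (@poly_foldl_grow _ _ _ _ _ _ (fun p st _ => augment p.1.1 p.1.2 st)
  (fun p => (p.2, [::])) (fun p => p.2) pa _ _ (fun _ => 10)); polyt.
  exact: polybound_const.
move=> p [R0 b] e; rewrite /augment; case: ifP => _; last by lia.
by rewrite !sz_pair sz_trace sz_cons; rewrite (_ : sz true = 3) // [(R0, b).1]/= [(R0, b).2]/=; lia.
Qed.

Lemma poly_coverage T {eT : enc T} (D : T -> seq demand) (R : T -> seq arc) :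
  poly D -> poly R -> poly (fun x => coverage (D x) (R x)).
Proof.
move=> pD pR; rewrite /coverage; polyt; apply: poly_maxflow; polyt.
by apply: (poly_call (h := R)); polyt.
Qed.

Lemma poly_cov T {eT : enc T} (N : T -> network) (A : T -> seq item) :
  poly N -> poly A -> poly (fun x => cov (N x) (A x)).
Proof. by move=> pN pA; apply: poly_coverage; polyt. Qed.

Ltac poly_cov := polyt; repeat (apply: poly_cov; polyt).

Lemma poly_cands T {eT : enc T} (N : T -> network) (items A : T -> seq item) :
  poly N -> poly items -> poly A -> poly (fun x => cands (N x) (items x) (A x)).
Proof.
move=> pN pi pA; rewrite /cands; polyt.
- by apply: (poly_call (h := A)); polyt.
- by apply: poly_cov; [apply: (poly_call (h := N)) | apply: (poly_call (h := A))]; polyt.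
- apply: poly_cov; first by apply: (poly_call (h := N)); polyt.
  by polyt; apply: (poly_call (h := A)); polyt.
Qed.

Lemma pick_mem N items A : {subset pick N items A <= items} /\ size (pick N items A) <= 1.
Proof.
rewrite /pick; set l := cands N items A.
have : {subset l <= items} by move=> x; rewrite mem_filter => /andP [].
move: l => l; have : {subset ([::] : seq item) <= items} by [].
have : size ([::] : seq item) <= 1 by [].
elim: l [::] => [|x l IH] b //= sb hb hl; apply: IH.
- by rewrite /pick1; case: b sb {hb} => [|y b] //=; case: ifP.
- have xi : x \in items by apply: hl; rewrite mem_head.
  have hx : {subset [:: x] <= items} by move=> z; rewrite inE => /eqP ->.
  by rewrite /pick1; case: b {sb} hb => [|y b] //=; case: ifP.
- by move=> z zl; apply: hl; rewrite inE zl orbT.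
Qed.

Lemma poly_pick T {eT : enc T} (N : T -> network) (items A : T -> seq item) :
  poly N -> poly items -> poly A -> poly (fun x => pick (N x) (items x) (A x)).
Proof.
move=> pN pi pA.
apply: (poly_call (h := fun p : network * seq item * seq item => pick p.1.1 p.1.2 p.2)
  (f := fun x => (N x, items x, A x))); last by polyt.
have pb : poly (fun p : network * seq item * seq item * seq item * item =>
    pick1 p.1.1.1.1 p.1.1.2 p.1.2 p.2).
  apply: (poly_seq_case
    (l := fun p : network * seq item * seq item * seq item * item => p.1.2)
    (f := fun p y _ => if better p.1.1.1.1 p.1.1.2 p.2 y then [:: p.2] else p.1.2)
    (h := fun p => [:: p.2])); rewrite /better; poly_cov.
apply: (@poly_foldl_grow _ _ _ _ _ _ (fun p b x => pick1 p.1.1 p.2 b x)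
  (fun _ => [::]) (fun p => cands p.1.1 p.1.2 p.2) pb _ _ (fun p => sz p)); polyt.
- by apply: poly_cands; polyt.
- exact: polybound_sz.
move=> p b x; rewrite !sz_pair.
have h0 : sz [:: x] = sz x + 2 by rewrite sz_cons addn2 addn1.
have h1 : 0 < sz p by exact: sz_gt0.
have h2 : 0 < sz b by exact: sz_gt0.
by rewrite /pick1; case: b h2 => [|y b] h2; [|case: ifP => _]; rewrite ?h0; lia.
Qed.

Lemma poly_greedy T {eT : enc T} (N : T -> network) (items : T -> seq item) :
  poly N -> poly items -> poly (fun x => greedy (N x) (items x)).
Proof.
move=> pN pi.
apply: (poly_call (h := fun p : network * seq item => greedy p.1 p.2)
  (f := fun x => (N x, items x))); last by polyt.
have pb : poly (fun p : network * seq item * seq item * item =>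
    pick p.1.1.1 p.1.1.2 p.1.2 ++ p.1.2).
  by polyt; apply: poly_pick; polyt.
apply: (@poly_foldl_grow _ _ _ _ _ _ (fun p A _ => pick p.1 p.2 A ++ A)
  (fun _ => [::]) (fun p => p.2) pb _ _ (fun p => sz p)); polyt.
  exact: polybound_sz.
move=> [N0 it] A x /=; have := pick_mem N0 it A.
case: (pick N0 it A) => [|y [|z l]] [sub sz1] //=; first by lia.
have yi : y \in it by apply: sub; rewrite mem_head.
have : sz y < sz it by exact: sz_mem.
by rewrite sz_cons !sz_pair; lia.
Qed.

(** * Max-flow min-cut *)

Definition cut (X : pred node) (R : seq arc) : nat :=
  count (fun e : arc => X e.1 && ~~ X e.2) R.

Definition netout (K : seq arc) (u : node) : int :=
  ((count (fun e => e.1 == u) K)%:Z - (count (fun e => e.2 == u) K)%:Z)%R.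

(** With unit capacities an integral flow is a sub-multiset [K] of the arcs; [b] prescribes its net
    outflow at every node. *)
Definition hasflow (R : seq arc) (b : node -> int) : Prop :=
  exists2 K, (forall e, count_mem e K <= count_mem e R) & forall u, netout K u = b u.

Lemma perm_cut X R R' : perm_eq R R' -> cut X R = cut X R'.
Proof. by move/permP; apply. Qed.

Lemma cut_swap X e R : e \in R -> cut X (swap e R) + X e.1 = cut X R + X e.2.
Proof.
case/swap_perm => r /(perm_cut X) -> /(perm_cut X) ->; rewrite /cut /=.
by case: (X e.1); case: (X e.2) => /=; lia.
Qed.

(** If the flow uses the reversed arc, that arc is deleted; otherwise [e] is added, as a copy of it
    is free in [R]. Both changes have the same effect on the balance. *)
Lemma hasflow_swap e R b : e \in R -> hasflow (swap e R) b ->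
  hasflow R (fun u => b u + (u == e.1)%:Z - (u == e.2)%:Z)%R.
Proof.
move=> eR; have [r p1 p2] := swap_perm eR; case=> K HK Hb.
have [inK|ninK] := boolP ((e.2, e.1) \in K).
  have pK := perm_to_rem inK.
  exists (rem (e.2, e.1) K) => [x|u].
    have := HK x; rewrite (permP pK) (permP p1) (permP p2) /=; lia.
  rewrite -Hb /netout !(permP pK) /= [u == _]eq_sym [u == e.2]eq_sym.
  by case: (e.1 == u); case: (e.2 == u); lia.
exists (e :: K) => [x|u].
  have := HK x; rewrite (permP p1) (permP p2).
  have -> : count_mem x ((e.2, e.1) :: r) = ((e.2, e.1) == x) + count_mem x r by [].
  have -> : count_mem x (e :: K) = (e == x) + count_mem x K by [].
  have -> : count_mem x (e :: r) = (e == x) + count_mem x r by [].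
  by have [<-|_] := eqVneq (e.2, e.1) x; rewrite ?(count_memPn ninK); lia.
rewrite -Hb /netout /= [u == _]eq_sym [u == e.2]eq_sym.
by case: (e.1 == u); case: (e.2 == u); lia.
Qed.

Fixpoint is_search (s : node) (vis : seq arc) : bool :=
  if vis is e :: r then [&& e.1 \in reached s r, e.2 \notin reached s r & is_search s r]
  else true.

(** The effects of the single reversals telescope along the path, so that inner nodes cancel and
    only [s] and [t] remain. *)
Lemma trace_spec s t R vis :
  is_search s vis -> {subset vis <= R} -> t \in reached s vis ->
  (forall X, cut X (trace t R vis).2 + X s = cut X R + X t) /\
  (forall b, hasflow (trace t R vis).2 b ->
     hasflow R (fun u => b u + (u == s)%:Z - (u == t)%:Z)%R).
Proof.
rewrite /trace; elim: vis t R => [|e r IH] t R /=.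
  rewrite inE => _ _ /eqP ->; split=> // b [K HK Hb]; exists K => // u.
  by rewrite Hb; lia.
case/and3P => e1 e2 gr sub; have eR : e \in R by apply: sub; rewrite mem_head.
rewrite {1}/reached /= !inE {1}/trace1 /= => tin.
have [et|et] := eqVneq e.2 t; last first.
  have -> : trace1 (t, R) e = (t, R) by rewrite /trace1 (negbTE et).
  apply: IH => //; first by move=> x xr; apply: sub; rewrite inE xr orbT.
  by move: tin; rewrite eq_sym [t == e.2]eq_sym (negbTE et) /= inE eq_sym.
have -> : trace1 (t, R) e = (e.1, swap e R) by rewrite /trace1 et eqxx.
have [|HX Hf] := IH e.1 (swap e R) gr _ e1.
  (* Older arcs of the tree survive the swap: they differ from [e], whose head was new when [e] was
     added. *)
  move=> x xr; have xe : x != e.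
    by apply: contraNneq e2 => <-; rewrite inE map_f ?orbT.
  have xR : x \in R by apply: sub; rewrite inE xr orbT.
  have [r' p1 p2] := swap_perm eR; rewrite (perm_mem p2) inE.
  by move: xR; rewrite (perm_mem p1) inE (negbTE xe) /= => ->; rewrite orbT.
split=> [X|b Hb].
  by rewrite HX cut_swap // et.
have [K HK HKb] := hasflow_swap eR (Hf b Hb).
by exists K => // u; rewrite HKb et; ring.
Qed.

Lemma is_search_uniq s vis : is_search s vis -> uniq vis.
Proof.
elim: vis => //= e r IH /and3P [_ e2 /IH ->]; rewrite andbT.
by apply: contra e2 => er; rewrite inE map_f ?orbT.
Qed.

Lemma search_spec s R :
  [/\ is_search s (search s R), {subset search s R <= R}
    & frontier s R (search s R) = [::]].
Proof.
have step (l : seq arc) : let v := foldl (fun vis (_ : arc) => grow s R vis) [::] l in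
  [/\ is_search s v, {subset v <= R} & frontier s R v = [::] \/ size v = size l].
  elim/last_ind: l => [|l x IH] /=; first by split=> //; right.
  rewrite -cats1 foldl_cat /=; move: IH; set v := foldl _ _ l => -[gv sv cv].
  rewrite /grow; case E : (frontier s R v) cv => [|e f] cv; first by split=> //; left.
  have : e \in frontier s R v by rewrite E mem_head.
  rewrite mem_filter => /andP [/andP [e1 e2] eR].
  split=> /=.
  - by rewrite e1 e2 gv.
  - by move=> y; rewrite inE => /predU1P [->|/sv].
  - by right; case: cv => // ->; rewrite size_cat addn1.
have [g sub [E|sz]] := step ((s, s) :: R); first by split.
have := uniq_leq_size (is_search_uniq g) sub.
by rewrite sz /= ltnn.
Qed.

Lemma maxflow_spec s t R : s != t ->
  [/\ forall X : pred node, X s -> ~~ X t -> maxflow s t R <= cut X R,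
      exists X : pred node, [/\ X s, ~~ X t & cut X R = maxflow s t R]
    & hasflow R (fun u => (maxflow s t R)%:Z * ((u == s)%:Z - (u == t)%:Z))%R].
Proof.
move=> st.
(* Loop invariant: every s-t cut has lost exactly the number of augmentations, residual flows can be
   pulled back to [R], and either each round has augmented or some cut is empty. *)
have step (l : seq arc) : let v := foldl (fun st _ => augment s t st) (R, [::]) l in
  [/\ forall X : pred node, X s -> ~~ X t -> cut X v.1 + size v.2 = cut X R,
    forall b, hasflow v.1 b ->
      hasflow R (fun u => b u + (size v.2)%:Z * ((u == s)%:Z - (u == t)%:Z))%R &
    size v.2 = size l \/ exists X : pred node, [/\ X s, ~~ X t & cut X v.1 = 0]].
  elim/last_ind: l => [|l x IH] /=.
    split; [by move=> X *; rewrite addn0 | | by left].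
    by move=> b [K HK Hb]; exists K => // u; rewrite Hb; lia.
  rewrite -cats1 foldl_cat /=; move: IH; set v := foldl _ _ l => -[cv fv zv].
  have [g sub cl] := search_spec s v.1.
  rewrite /augment; case: ifP => tin.
    have [|HX Hf] := trace_spec g sub (t := t); first by rewrite inE tin orbT.
    split=> /=.
    - by move=> X Xs Xt; rewrite -(cv X) //; have := HX X; rewrite Xs (negbTE Xt); lia.
    - move=> b /Hf /fv [K HK Hb]; exists K => // u; rewrite Hb; lia.
    - case: zv => [->|[X [Xs Xt X0]]]; first by left; rewrite size_cat addn1.
      by have := HX X; rewrite Xs (negbTE Xt) X0; lia.
  split=> //; right; exists (fun x => x \in reached s (search s v.1)); split.
  - by rewrite mem_head.
  - by rewrite inE tin orbF eq_sym.
  - apply/eqP; rewrite -leqn0 leqNgt -has_count; apply/hasPn => e ev.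
    apply/negP => /= H; suff : e \in frontier s v.1 (search s v.1) by rewrite cl.
    by rewrite mem_filter H.
rewrite /maxflow; have [cv fv zv] := step R; set v := foldl _ _ R in cv fv zv *.
split.
- by move=> X Xs Xt; rewrite -(cv X) // leq_addl.
- case: zv => [zv|[X [Xs Xt X0]]]; last by exists X; split=> //; rewrite -(cv X) // X0.
  (* All [size R] rounds have augmented. The cut of [s] alone has at most [size R] arcs, hence is
     tight. *)
  have ts : ~~ pred1 s t by rewrite /= eq_sym.
  have c1 : cut (pred1 s) R <= size R by exact: count_size.
  have c2 := cv (pred1 s) (eqxx s) ts.
  by exists (pred1 s); split=> //; [exact: eqxx | lia].
(* The flow is the empty flow of the last residual graph, pulled back through all reversals. *)
- have [|K HK Hb] := fv (fun _ => 0%R); first by exists [::] => // u; rewrite /netout /=; lia.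
  by exists K => // u; rewrite Hb GRing.add0r.
Qed.

(** * Submodularity of the coverage *)

Lemma cut_cat X R P : cut X (R ++ P) = cut X R + cut X P.
Proof. exact: count_cat. Qed.

Lemma maxflow_mono s t R R' : s != t -> (forall X, cut X R <= cut X R') ->
  maxflow s t R <= maxflow s t R'.
Proof.
move=> st le; have [H1 _ _] := maxflow_spec R st.
have [_ [X [Xs Xt <-]] _] := maxflow_spec R' st.
exact: leq_trans (H1 X Xs Xt) (le X).
Qed.

Lemma maxflow_cat_le s t R P : s != t -> maxflow s t (R ++ P) <= maxflow s t R + size P.
Proof.
move=> st; have [H1 _ _] := maxflow_spec (R ++ P) st.
have [_ [X [Xs Xt <-]] _] := maxflow_spec R st.
by apply: leq_trans (H1 X Xs Xt) _; rewrite cut_cat leq_add2l; exact: count_size.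
Qed.

Lemma cut_submod (X Y : pred node) R :
  cut (predI X Y) R + cut (predU X Y) R <= cut X R + cut Y R.
Proof.
elim: R => //= e R; rewrite /cut /=.
by case: (X e.1); case: (Y e.1); case: (X e.2); case: (Y e.2) => /=; lia.
Qed.

Lemma sub_in_count (T : eqType) (a b : pred T) (s : seq T) :
  {in s, subpred a b} -> count a s <= count b s.
Proof.
elim: s => //= x s IH ab; apply: leq_add.
  by have := ab x (mem_head _ _); case: (a x) => // ->.
by apply: IH => y ys; apply: ab; rewrite inE ys orbT.
Qed.

(** Take minimum cuts [X] for [R ++ P] and [Y] for [R ++ Q]. If [a] lies in both, an arc of [P]
    leaving the union also leaves [X], and an arc of [Q] also leaves [Y]; so the union bounds the
    flow with all arcs and the intersection that of [R]. Otherwise no new arc leaves the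
    intersection, and the two cuts exchange roles. *)
Lemma maxflow_submod (s t : node) (R P Q : seq arc) (a : node) : s != t ->
  (forall e : arc, e \in P ++ Q -> e.1 = a) ->
  maxflow s t (R ++ P ++ Q) + maxflow s t R <= maxflow s t (R ++ P) + maxflow s t (R ++ Q).
Proof.
move=> st star.
have [H1 _ _] := maxflow_spec (R ++ P ++ Q) st; have [H2 _ _] := maxflow_spec R st.
have [_ [X [Xs Xt <-]] _] := maxflow_spec (R ++ P) st.
have [_ [Y [Ys Yt <-]] _] := maxflow_spec (R ++ Q) st.
have sub := cut_submod X Y R; rewrite !cut_cat in H1 *.
have sP : {subset P <= P ++ Q} by move=> x; rewrite mem_cat => ->.
have sQ : {subset Q <= P ++ Q} by move=> x; rewrite mem_cat orbC => ->.
have Is : predI X Y s by rewrite /= Xs Ys.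
have It : ~~ predI X Y t by rewrite /= (negbTE Xt).
have Us : predU X Y s by rewrite /= Xs.
have Ut : ~~ predU X Y t by rewrite /= negb_or Xt Yt.
have [/andP [Xa Ya]|Ia] := boolP (predI X Y a).
  have cU (Z : pred node) L : {subset L <= P ++ Q} -> Z a -> subpred Z (predU X Y) ->
      cut (predU X Y) L <= cut Z L.
    move=> sL Za ZU; apply: sub_in_count => e /sL /star -> /andP [_ U].
    by rewrite Za; apply: contra U; apply: ZU.
  have h1 := H1 _ Us Ut; have h2 := H2 _ Is It.
  have h3 : cut (predU X Y) P <= cut X P by apply: cU => // x /= ->.
  have h4 : cut (predU X Y) Q <= cut Y Q by apply: cU => // x /= ->; rewrite orbT.
  by move: h1 h2 h3 h4 sub; rewrite !cut_cat; clear; lia.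
have c0 L : {subset L <= P ++ Q} -> cut (predI X Y) L = 0.
  move=> sL; apply/eqP; rewrite -leqn0 leqNgt -has_count; apply/hasPn => e /sL /star ->.
  by rewrite (negbTE Ia).
have h1 := H1 _ Is It; have h2 := H2 _ Us Ut.
by move: h1 h2 sub (c0 P sP) (c0 Q sQ); rewrite !cut_cat; clear; lia.
Qed.

(** Capping at the requirement preserves submodularity thanks to monotonicity, which provides the
    first two hypotheses. *)
Lemma minn_submod r a b c d : a <= b -> a <= c -> d + a <= b + c ->
  minn r d + minn r a <= minn r b + minn r c.
Proof. by lia. Qed.

Lemma leq_sum_in (I : eqType) (s : seq I) (F G : I -> nat) :
  (forall i, i \in s -> F i <= G i) -> \sum_(i <- s) F i <= \sum_(i <- s) G i.
Proof. by move=> H; rewrite big_seq [X in _ <= X]big_seq leq_sum. Qed.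

Section Coverage.
Variable D : seq demand.
Hypothesis Dneq : forall d : demand, d \in D -> d.1.1 != d.1.2.

Lemma coverageE R : coverage D R = \sum_(d <- D) minn d.2 (maxflow d.1.1 d.1.2 R).
Proof. by rewrite /coverage sumnE big_map. Qed.

Lemma coverage_mono R R' : (forall X, cut X R <= cut X R') -> coverage D R <= coverage D R'.
Proof.
move=> le; rewrite !coverageE; apply: leq_sum_in => d dD.
by rewrite leq_min geq_minl (leq_trans (geq_minr _ _)) // maxflow_mono // Dneq.
Qed.

Lemma coverage_submod (R P Q : seq arc) (a : node) : (forall e : arc, e \in P ++ Q -> e.1 = a) ->
  coverage D (R ++ P ++ Q) + coverage D R <= coverage D (R ++ P) + coverage D (R ++ Q).
Proof.
move=> star; rewrite !coverageE -!big_split /=; apply: leq_sum_in => d dD.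
have sm := maxflow_submod R (Dneq dD) star.
have [m1 m2] : maxflow d.1.1 d.1.2 R <= maxflow d.1.1 d.1.2 (R ++ P) /\
    maxflow d.1.1 d.1.2 R <= maxflow d.1.1 d.1.2 (R ++ Q).
  by split; apply: maxflow_mono (Dneq dD) _ => X; rewrite cut_cat leq_addr.
exact: minn_submod.
Qed.

Lemma coverage_cat_le R P :
  coverage D (R ++ P) <= coverage D R + \sum_(d <- D) minn d.2 (size P).
Proof.
rewrite !coverageE -!big_split /=; apply: leq_sum_in => d dD.
by move: (maxflow_cat_le R P (Dneq dD)); clear; lia.
Qed.

Lemma coverage_le R : coverage D R <= \sum_(d <- D) d.2.
Proof. by rewrite coverageE leq_sum // => d _; rewrite geq_minl. Qed.

Lemma coverage_full R :
  (coverage D R == \sum_(d <- D) d.2) = all (fun d => d.2 <= maxflow d.1.1 d.1.2 R) D.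
Proof.
rewrite coverageE eqn_leq leq_sum /=; last by move=> d _; rewrite geq_minl.
elim: D => [|d D' IH]; first by rewrite !big_nil.
rewrite !big_cons /= -IH; have : \sum_(j <- D') minn j.2 (maxflow j.1.1 j.1.2 R) <=
  \sum_(j <- D') j.2 by apply: leq_sum => e _; rewrite geq_minl.
by set a := \sum_(_ <- _) _; set b := \sum_(_ <- _) _; lia.
Qed.

End Coverage.

(** * Analysis of the greedy algorithm *)

Section HarmonicNumbers.
Local Open Scope ring_scope.

Lemma H0 : H 0 = 0.
Proof. by rewrite /H big_geq. Qed.

Lemma HS n : H n.+1 = H n + n.+1%:R^-1.
Proof. by rewrite /H big_nat_recr. Qed.

(** The difference has [m - n] terms, each at least [1 / m]. *)
Lemma H_diff m n : (n <= m)%N -> (m - n)%:R / m%:R <= H m - H n.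
Proof.
move=> nm; rewrite -(subnKC nm) addKn; elim: (m - n)%N => [|k IH].
  by rewrite addn0 mul0r subrr.
rewrite addnS HS; have [->|k0] := posnP k.
  by rewrite addn0 addrAC subrr add0r mul1r.
have p1 : 0 < (n + k)%:R :> rat by rewrite ltr0n addn_gt0 k0 orbT.
have p2 : 0 < (n + k).+1%:R :> rat by rewrite ltr0n.
apply: (@le_trans _ _ (k%:R / (n + k)%:R + (n + k).+1%:R^-1)); last by rewrite addrAC lerD2r.
rewrite -[in X in X <= _](addn1 k) natrD mulrDl mul1r lerD2r.
by rewrite ler_pM2l ?ltr0n // lef_pV2 // ler_nat.
Qed.

Lemma H_mono m n : (n <= m)%N -> H n <= H m.
Proof. by move=> nm; rewrite -subr_ge0; apply: le_trans (H_diff nm); rewrite divr_ge0. Qed.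

Lemma H_ge1 n : (0 < n)%N -> 1 <= H n.
Proof. by move=> n0; apply: le_trans (H_mono n0); rewrite HS H0 add0r. Qed.

Lemma H_ge0 n : 0 <= H n.
Proof. by rewrite -H0 H_mono. Qed.

End HarmonicNumbers.

(** * Gains, diminishing returns and the cost of the greedy solution *)

Section Greedy.

Variables (N : network) (items : seq item) (a : node).
Hypothesis Dneq : forall d : demand, d \in N.2 -> d.1.1 != d.1.2.
Hypothesis star : forall (x : item) (e : arc), x \in items -> e \in x.2.1 -> e.1 = a.
Hypothesis uniq_idx : uniq [seq x.1 | x <- items].
Hypothesis den_gt0 : forall x : item, x \in items -> 0 < x.2.2.2.

Definition arcs (A : seq item) : seq arc := flatten [seq x.2.1 | x <- A].

Lemma coverage_cut_eq D R R' : (forall d : demand, d \in D -> d.1.1 != d.1.2) ->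
  (forall X, cut X R = cut X R') -> coverage D R = coverage D R'.
Proof.
move=> neq E; apply/eqP; rewrite eqn_leq.
by rewrite !coverage_mono // => X; rewrite E.
Qed.

Lemma cut_arcs X A : cut X (arcs A) = \sum_(x <- A) cut X x.2.1.
Proof. by elim: A => [|x A IH]; rewrite ?big_nil // big_cons -IH -cut_cat. Qed.

Lemma cov_mono A B : (forall x, count_mem x A <= count_mem x B) -> cov N A <= cov N B.
Proof.
move=> le; apply: coverage_mono => // X; rewrite !cut_cat leq_add2l !cut_arcs.
by apply: sub_le_big_seq => // m n; exact: leq_addr.
Qed.

Lemma cov_le A : cov N A <= \sum_(d <- N.2) d.2.
Proof. exact: coverage_le. Qed.

Definition gain (A : seq item) (x : item) : nat := cov N (x :: A) - cov N A.

Lemma cov_cons A x : cov N (x :: A) = cov N A + gain A x.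
Proof. by rewrite subnKC //; apply: cov_mono => y /=; exact: leq_addl. Qed.

Lemma gain_anti A x y : x \in items -> y \in items -> gain (x :: A) y <= gain A y.
Proof.
move=> xi yi; rewrite -(leq_add2l (cov N (x :: A))) -cov_cons.
rewrite -(leq_add2r (cov N A)) -addnA [gain A y + _]addnC -cov_cons addnC [cov N (x :: A) + _]addnC.
have st : forall e : arc, e \in y.2.1 ++ x.2.1 -> e.1 = a.
  by move=> e; rewrite mem_cat => /orP [|] /star; exact.
have := coverage_submod Dneq (N.1 ++ arcs A) st.
rewrite addnC; congr (_ + _ <= _ + _); apply: coverage_cut_eq => // X;
  by rewrite /arcs /= !cut_cat; clear; lia.
Qed.

Lemma gain_anti_cat A B y : {subset B <= items} -> y \in items -> gain (B ++ A) y <= gain A y.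
Proof.
move=> + yi; elim: B => //= x B IH sub.
apply: leq_trans (gain_anti _ _ yi) (IH _) => [|z zB]; apply: sub; first exact: mem_head.
by rewrite inE zB orbT.
Qed.

(** Items form lists, so a second copy of a chosen item would add its arcs again and could still
    have positive [gain]; repetitions are declared worthless. *)
Definition mgain (A : seq item) (y : item) : nat := if y \in A then 0 else gain A y.

(** The items of [S] missing from [A] are added one at a time; by diminishing returns each gains at
    most what it would gain directly after [A]. *)
Lemma cov_sub_le (S A : seq item) : uniq S -> {subset S <= items} ->
  cov N S <= cov N A + \sum_(y <- S) mgain A y.
Proof.
move=> uS sS; pose L := [seq y <- S | y \notin A].
have sL : {subset L <= items} by move=> y; rewrite mem_filter => /andP [_ /sS].
apply: (@leq_trans (cov N (L ++ A))).
  apply: cov_mono => y; apply: (@leq_trans (y \in S)).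
    by rewrite count_uniq_mem.
  rewrite count_cat -!has_pred1; case: (boolP (y \in A)) => yA; last first.
    case: (boolP (has _ S)); rewrite ?has_pred1 // => yS.
    by rewrite addn_gt0 -!has_count !has_pred1 mem_filter yA yS.
  have : 0 < count_mem y A by rewrite -has_count has_pred1.
  by case: has => /=; lia.
have -> : \sum_(y <- S) mgain A y = \sum_(y <- L) gain A y.
  by rewrite big_filter [RHS]big_mkcond; apply: eq_bigr => y _; rewrite /mgain; case: (y \in A).
elim: L sL => [|y L IH] sL; first by rewrite big_nil addn0.
have yi : y \in items by apply: sL; rewrite mem_head.
have sL' : {subset L <= items} by move=> z zL; apply: sL; rewrite inE zL orbT.
by rewrite big_cons cat_cons cov_cons; have := IH sL'; have := gain_anti_cat A sL' yi; lia.
Qed.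

Definition price (x : item) : rat := (x.2.2.1%:R / x.2.2.2%:R)%R.

Lemma betterE A x y : x \in cands N items A -> y \in cands N items A ->
  better N A x y = (price x / (gain A x)%:R < price y / (gain A y)%:R)%R.
Proof.
rewrite !mem_filter => /andP [/andP [_ gx] xi] /andP [/andP [_ gy] yi].
have dx := den_gt0 xi; have dy := den_gt0 yi.
rewrite -subn_gt0 -/(gain A x) in gx; rewrite -subn_gt0 -/(gain A y) in gy.
rewrite /better /price -!/(gain _ _) -!mulrA -!invfM -!natrM.
rewrite ltr_pdivrMr ?ltr0n ?muln_gt0 ?dx //.
rewrite mulrAC ltr_pdivlMr ?ltr0n ?muln_gt0 ?dy // -!natrM ltr_nat.
by rewrite !mulnA.
Qed.

Lemma pick_spec A :
  (pick N items A = [::] /\ cands N items A = [::]) \/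
  exists x, [/\ pick N items A = [:: x], x \in cands N items A &
    forall y, y \in cands N items A ->
      (price x / (gain A x)%:R <= price y / (gain A y)%:R)%R].
Proof.
rewrite /pick; set C := cands N items A.
have step (l : seq item) : {subset l <= C} -> let b := foldl (pick1 N A) [::] l in
  (b = [::] /\ l = [::]) \/ exists x, [/\ b = [:: x], x \in C &
    forall y, y \in l -> (price x / (gain A x)%:R <= price y / (gain A y)%:R)%R].
  elim/last_ind: l => [|l y IH] sub /=; first by left.
  right; rewrite -cats1 foldl_cat /=.
  have yC : y \in C by apply: sub; rewrite mem_rcons mem_head.
  have [||] := IH; first by move=> z zl; apply: sub; rewrite mem_rcons inE zl orbT.
    case=> -> ->; exists y; split=> // z; by rewrite inE => /eqP ->.
  case=> x [-> xC xmin] /=; rewrite betterE //; case: ltP => [lt|ge].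
    exists y; split=> // z; rewrite mem_cat inE => /orP [/xmin|/eqP -> //].
    by apply: le_trans; exact: ltW.
  by exists x; split=> // z; rewrite mem_cat inE => /orP [/xmin|/eqP ->].
have [|//|[x [-> xC xmin]]] := step C; first by [].
  by left.
by right; exists x.
Qed.

Definition greedy_loop (A l : seq item) : seq item :=
  foldl (fun A (_ : item) => pick N items A ++ A) A l.

Lemma cands_mem A x : x \in cands N items A ->
  [/\ x \in items, x \notin A & 0 < gain A x].
Proof.
rewrite mem_filter -subn_gt0 => /andP [/andP [xA gx] xi]; split=> //.
by apply: contra xA => xA; exact: map_f.
Qed.

Lemma mem_cands A x : {subset A <= items} -> x \in items -> x \notin A -> 0 < gain A x ->
  x \in cands N items A.
Proof.
move=> sA xi xA gx; rewrite mem_filter xi -subn_gt0 gx !andbT.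
apply/mapP => -[y yA xy]; move: xA; rewrite (_ : x = y) ?yA //.
have sA' := sA _ yA; rewrite -(nth_index x xi) -(nth_index x sA').
congr (nth _ _ _); apply/eqP; rewrite -(nth_uniq 0 _ _ uniq_idx) ?size_map ?index_mem //.
by rewrite !(nth_map x) ?index_mem // !nth_index // xy.
Qed.

Lemma greedy_loop_spec l : let A := greedy_loop [::] l in
  [/\ uniq A, {subset A <= items} & size A = size l \/ cands N items A = [::]].
Proof.
elim/last_ind: l => [|l z IH] /=; first by split=> //; left.
rewrite /greedy_loop -cats1 foldl_cat /=; move: IH; rewrite /greedy_loop.
set A := foldl _ _ l => -[uA sA cA]; case: (pick_spec A) => [[-> E]|[x [-> xC _]]] /=.
  by split=> //; right.
have [xi xA _] := cands_mem xC; split.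
- by rewrite /= xA.
- by move=> y; rewrite inE => /predU1P [->|/sA].
- by left; case: cA => [->|E]; [rewrite size_cat addn1 | move: xC; rewrite E].
Qed.

Lemma greedy_uniq : uniq (greedy N items).
Proof. by have [] := greedy_loop_spec items. Qed.

Lemma greedy_sub : {subset greedy N items <= items}.
Proof. by have [] := greedy_loop_spec items. Qed.

(** Had every round found a candidate, all items would be chosen and none would be left. *)
Lemma greedy_cands : cands N items (greedy N items) = [::].
Proof.
have [uA sA [sz|//]] := greedy_loop_spec items; rewrite -/(greedy N items) in uA sA sz *.
have [_ E] := uniq_min_size uA sA (eq_leq (esym sz)).
case C : (cands _ _ _) => [//|x r].
have : x \in cands N items (greedy N items) by rewrite C mem_head.
by case/cands_mem => xi; rewrite E xi.
Qed.

Lemma greedy_covers (S : seq item) : uniq S -> {subset S <= items} ->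
  cov N S <= cov N (greedy N items).
Proof.
move=> uS sS; apply: leq_trans (cov_sub_le _ uS sS) _.
rewrite big_seq big1 ?addn0 // => y /sS yi; rewrite /mgain; case: ifPn => // yA.
apply/eqP; rewrite -leqn0 leqNgt; apply/negP => g.
by have := mem_cands greedy_sub yi yA g; rewrite greedy_cands.
Qed.

Local Open Scope ring_scope.

Lemma price_ge0 x : 0 <= price x.
Proof. by rewrite divr_ge0. Qed.

(* The potential of Wolsey's analysis: [th] is a lower bound on the current
   cost per unit of gain, and each unit still to be covered is charged [th]. *)
Lemma greedy_cost (S A l : seq item) (th : rat) : uniq S -> {subset S <= items} ->
  {subset A <= items} -> (cov N (greedy_loop A l) <= cov N S)%N -> 0 <= th ->
  (forall y, y \in items -> th * (mgain A y)%:R <= price y) ->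
  \sum_(x <- greedy_loop A l) price x <= \sum_(x <- A) price x +
     th * ((cov N S)%:R - (cov N A)%:R) +
     \sum_(y <- S) (price y * H (mgain A y) - th * (mgain A y)%:R).
Proof.
move=> uS sS; elim: l A th => [|z l IH] A th sA cS th0 hth.
  rewrite /= in cS *; rewrite -addrA lerDl addr_ge0 //.
    by rewrite mulr_ge0 // subr_ge0 ler_nat.
  rewrite big_seq sumr_ge0 // => y /sS yi; rewrite subr_ge0.
  have [->|g0] := posnP (mgain A y); first by rewrite H0 !mulr0.
  by apply: le_trans (hth y yi) _; rewrite ler_peMr ?price_ge0 ?H_ge1.
have : greedy_loop A (z :: l) = greedy_loop (pick N items A ++ A) l by [].
move=> E; rewrite E in cS *; case: (pick_spec A) => [[P _]|[x [P xC xmin]]]; rewrite {}P /= in cS *.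
  exact: IH.
have [xi xA gx] := cands_mem xC.
(* The ratio of the picked item is the new threshold: it is at least [th], and by minimality it
   still bounds the price per unit of gain of every item. *)
set th' := price x / (gain A x)%:R in xmin.
have gx' : 0 < (gain A x)%:R :> rat by rewrite ltr0n.
have px : price x = th' * (gain A x)%:R by rewrite /th' divfK // gt_eqF.
have th'0 : 0 <= th' by rewrite divr_ge0 ?price_ge0.
have hth' y : y \in items -> th' * (mgain A y)%:R <= price y.
  move=> yi; have [->|g0] := posnP (mgain A y); first by rewrite mulr0 price_ge0.
  move: g0; rewrite /mgain; case: ifPn => // yA g0.
  by rewrite -ler_pdivlMr ?ltr0n //; apply: xmin; exact: mem_cands.
have thth' : th <= th'.
  have := hth x xi; rewrite /mgain (negbTE xA) px.
  by rewrite ler_pM2r.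
have sA' : {subset x :: A <= items} by move=> y; rewrite inE => /predU1P [->|/sA].
have anti y : y \in items -> (mgain (x :: A) y <= mgain A y)%N.
  move=> yi; rewrite /mgain inE; case: (y == x) => //=; case: (y \in A) => //.
  exact: gain_anti.
apply: le_trans (IH (x :: A) th' sA' cS th'0 _) _.
  move=> y yi; apply: le_trans (hth' y yi); rewrite ler_wpM2l // ler_nat; exact: anti.
rewrite big_cons cov_cons natrD px.
set R := (cov N S)%:R - (cov N A)%:R.
have R_le : R <= \sum_(y <- S) (mgain A y)%:R.
  rewrite lerBlDr -natr_sum -natrD ler_nat addnC; exact: cov_sub_le.
(* With [u] and [v] the gains of [y] before and after the pick, each term amounts to
   [th' * (u - v) <= price y * (H u - H v)], which follows from [H_diff] and
   [th' * u <= price y]. *)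
have terms : (th' - th) * \sum_(y <- S) (mgain A y)%:R +
    \sum_(y <- S) (price y * H (mgain (x :: A) y) - th' * (mgain (x :: A) y)%:R) <=
    \sum_(y <- S) (price y * H (mgain A y) - th * (mgain A y)%:R).
  rewrite mulr_sumr -big_split /= big_seq [X in _ <= X]big_seq.
  apply: ler_sum => y /sS yi; have le := anti y yi; have := H_diff le.
  have := hth' y yi; move: le; set u := mgain A y; set v := mgain _ y => vu hu hH.
  have [u0|u0] := posnP u.
    by move: vu; rewrite u0 leqn0 => /eqP ->; rewrite H0 !mulr0 !subr0 ?addr0.
  have u0' : 0 < u%:R :> rat by rewrite ltr0n.
  have : th' * (u - v)%:R <= price y * (H u - H v).
    apply: (@le_trans _ _ (price y * ((u - v)%:R / u%:R))); last by rewrite ler_wpM2l ?price_ge0.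
    by rewrite [leRHS]mulrCA [leLHS]mulrC ler_wpM2l // ler_pdivlMr.
  rewrite natrB //; lra.
have := ler_wpM2l _ R_le; move=> /(_ (th' - th)); rewrite subr_ge0 => /(_ thth').
rewrite /R; lra.
Qed.

Theorem greedy_ratio (S : seq item) K : uniq S -> {subset S <= items} ->
  cov N S = (\sum_(d <- N.2) d.2)%N ->
  (forall y, y \in items -> (gain [::] y <= K)%N) ->
  \sum_(x <- greedy N items) price x <= H K * \sum_(y <- S) price y.
Proof.
move=> uS sS full gK.
have := @greedy_cost S [::] items 0 uS sS _ _ (lexx _).
rewrite full big_nil mul0r !add0r => /(_ _ (cov_le _) _) h.
apply: le_trans (h _ _) _ => //; first by move=> y _; rewrite mul0r price_ge0.
rewrite mulr_sumr big_seq [X in _ <= X]big_seq ler_sum // => y /sS yi.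
by rewrite mul0r subr0 mulrC ler_wpM2r ?price_ge0 // H_mono //; exact: gK.
Qed.

End Greedy.

(** * Node capacities *)

Section Split.

Variables (V : finType) (phi : V -> nat).
Hypothesis phi_inj : injective phi.

Definition split_arc (e : V * V) : arc := ((phi e.1, true), (phi e.2, false)).
Definition cap_arc (u : V) : arc := ((phi u, false), (phi u, true)).
Definition cap_arcs (q : V -> nat) : seq arc := flatten [seq nseq (q u) (cap_arc u) | u <- enum V].

Lemma cut_split X E :
  cut X (map split_arc E) = count (fun e => X (phi e.1, true) && ~~ X (phi e.2, false)) E.
Proof. exact: count_map. Qed.

Lemma count_cap (P : pred arc) q : count P (cap_arcs q) = \sum_u P (cap_arc u) * q u.
Proof.
rewrite /cap_arcs -big_enum /=; elim: (enum V) => [|u s IH]; first by rewrite big_nil.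
by rewrite big_cons /= count_cat count_nseq IH.
Qed.

Variables (E : seq (V * V)) (q : V -> nat) (s v : V).
Hypothesis sv : s != v.

Let R := map split_arc E ++ cap_arcs q.
(** The flow starts behind the capacity arcs of [s] and ends in front of those of [v], so these two
    capacities do not limit its value. *)
Let m := maxflow (phi s, true) (phi v, false) R.

Lemma endpoints_neq : (phi s, true) != (phi v, false).
Proof. by rewrite xpair_eqE andbF. Qed.

Local Open Scope ring_scope.

Lemma sum_outflow (f : 'I_(size E) -> rat) (B : pred V) :
  \sum_(u | B u) outflow f u = \sum_(e | B (edge e).1) f e.
Proof.
rewrite [RHS](partition_big (fun e => (edge e).1) B) //=; apply: eq_bigr => u Bu.
by apply: eq_bigl => e; have [->|] := eqVneq (edge e).1 u; rewrite ?andbF // Bu.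
Qed.

Lemma sum_inflow (f : 'I_(size E) -> rat) (A : pred V) :
  \sum_(u | A u) inflow f u = \sum_(e | A (edge e).2) f e.
Proof.
rewrite [RHS](partition_big (fun e => (edge e).2) A) //=; apply: eq_bigr => u Au.
by apply: eq_bigl => e; have [->|] := eqVneq (edge e).2 u; rewrite ?andbF // Au.
Qed.

Lemma count_edge (P : pred (V * V)) : count P E = (\sum_(e < size E) P (edge e))%N.
Proof.
rewrite -sum1_count big_mkcond [LHS]big_tnth.
by apply: eq_bigr => i _; rewrite /edge; case: (P _).
Qed.

Lemma flow_value_le (f : 'I_(size E) -> rat) : is_flow q s v f -> flow_value s f <= m%:R.
Proof.
case=> f01 fc; have [_ [X [Xs Xv mE]] _] := @maxflow_spec (phi s, true) (phi v, false) R endpoints_neq.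
(* [A] and [B] tell whether the entering and the leaving side of a vertex lie on the source shore;
   its capacity is cut when only [A] holds. *)
pose A u := X (phi u, false); pose B u := X (phi u, true).
have {}mE : (m = \sum_(e < size E) (B (edge e).1 && ~~ A (edge e).2) +
    \sum_u (A u && ~~ B u) * q u)%N.
  by rewrite /m -mE /R cut_cat cut_split count_edge /cut count_cap.
rewrite mE.
have inge u : 0 <= inflow f u by apply: sumr_ge0 => e _; have /andP [] := f01 e.
have outge u : 0 <= outflow f u by apply: sumr_ge0 => e _; have /andP [] := f01 e.
have step1 : flow_value s f <= \sum_(u | B u) outflow f u - \sum_(u | A u) inflow f u +
    \sum_u ((A u && ~~ B u) * q u)%:R.
  have -> : flow_value s f = \sum_u (if u == s then flow_value s f else 0).
    by rewrite -big_mkcond big_pred1_eq.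
  rewrite [\sum_(u | B u) _]big_mkcond [\sum_(u | A u) _]big_mkcond /= -sumrB -big_split /=.
  apply: ler_sum => u _; have iu := inge u; have ou := outge u.
  have [->|us] := eqVneq u s.
    rewrite /flow_value /A /B Xs andbF mul0n addr0.
    by case: (X _); have := inge s; lra.
  have [->|uv] := eqVneq u v.
    by rewrite /A (negbTE Xv) mul0n addr0 subr0; case: (B v).
  have [e1 e2] := fc u us uv.
  case: (A u); case: (B u); rewrite /= ?mul0n ?mul1n ?addr0 ?subr0; lra.
apply: le_trans step1 _; rewrite sum_outflow sum_inflow natrD -natr_sum lerD2r.
rewrite big_mkcond [X in _ - X]big_mkcond -sumrB natr_sum; apply: ler_sum => e _.
have /andP [f0 f1] := f01 e.
by case: (B _); case: (A _) => /=; lra.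
Qed.

Lemma sum_mask (P : pred (V * V)) (b : bitseq) : size b = size E ->
  \sum_(e < size E | P (edge e)) (nth false b e)%:R = (count P (mask b E))%:R :> rat.
Proof.
move=> sb; have -> : \sum_(e < size E | P (edge e)) (nth false b e)%:R =
    \sum_(0 <= i < size E | P (nth (s, s) E i)) (nth false b i)%:R :> rat.
  by rewrite big_mkord; apply: eq_bigl => i; rewrite /edge (tnth_nth (s, s)).
elim: E b sb => [|e E' IH] [|c b] //=; first by rewrite big_nil.
case=> sb.
rewrite big_mkcond big_nat_recl //= -big_mkcond /= IH //.
by case: c; case Pe : (P e) => /=; rewrite ?Pe ?add0r ?natrD.
Qed.

(** Of the integral flow [K] only the arcs coming from edges are kept; the number [c u] of its
    capacity arcs at [u] is the throughput of [u], bounded by [q u]. *)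
Lemma flow_exists : exists2 f : 'I_(size E) -> rat, is_flow q s v f & flow_value s f = m%:R.
Proof.
have [_ _ [K HK Hb]] := @maxflow_spec (phi s, true) (phi v, false) R endpoints_neq.
rewrite -/m in Hb.
have KR x : x \in K -> x \in R.
  by rewrite -!has_pred1 !has_count => /leq_trans; apply; exact: HK.
have Rcase x : x \in R -> (exists e, x = split_arc e) \/ (exists u, x = cap_arc u).
  rewrite mem_cat => /orP [/mapP [e _ ->]|]; first by left; exists e.
  by case/flattenP => l /mapP [u _ ->]; rewrite mem_nseq => /andP [_ /eqP ->]; right; exists u.
pose K' := [seq e <- K | e.1.2].
(* Parallel edges give equal arcs; the mask assigns the arcs of [K'] to definite positions in
   [E]. *)
have [b sb pb] : exists2 b, size b = size (map split_arc E) & perm_eq K' (mask b (map split_arc E)).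
  apply/count_maskP => e; rewrite /K' count_filter.
  have [e1|/negP e1] := boolP e.1.2; last first.
    rewrite (@eq_count _ _ pred0) ?count_pred0 // => x /=; apply/andP => -[/eqP ->]; exact: e1.
  apply: leq_trans (_ : (count_mem e K <= _)%N); first by apply: sub_count => x /= /andP [].
  apply: leq_trans (HK e) _; rewrite /R count_cat count_cap big1 ?addn0 // => u _.
  have E1 : cap_arc u != e by apply: contraTneq e1 => <-.
  by rewrite [pred1 _ _](negbTE E1).
rewrite size_map in sb.
have cf (P : pred arc) : \sum_(e < size E | P (split_arc (edge e))) (nth false b e)%:R =
    (count (fun e => P e && e.1.2) K)%:R :> rat.
  rewrite (sum_mask (P \o split_arc) sb) -count_filter -/K' (permP pb) -map_mask.
  by rewrite count_map.
pose f (e : 'I_(size E)) : rat := (nth false b e)%:R.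
have inE u : inflow f u = (count (fun e => e.2 == (phi u, false)) K)%:R.
  rewrite -(@eq_in_count _ (fun e => (e.2 == (phi u, false)) && e.1.2)); last first.
    by move=> x /KR /Rcase [[e ->]|[w ->]]; rewrite /= ?andbT // andbF; apply/esym/eqP => -[].
  rewrite -cf; apply: eq_bigl => e; rewrite /= xpair_eqE andbT.
  by rewrite (inj_eq phi_inj).
have outE u : outflow f u = (count (fun e => e.1 == (phi u, true)) K)%:R.
  rewrite -(@eq_in_count _ (fun e => (e.1 == (phi u, true)) && e.1.2)); last first.
    by move=> x /KR /Rcase [[e ->]|[w ->]]; rewrite /= ?andbT // andbF; apply/esym/eqP => -[].
  rewrite -cf; apply: eq_bigl => e; rewrite /= xpair_eqE andbT.
  by rewrite (inj_eq phi_inj).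
pose c u := count_mem (cap_arc u) K.
have capo u : count (fun e => e.1 == (phi u, false)) K = c u.
  apply: eq_in_count => x /KR /Rcase [[e ->]|[w ->]]; rewrite /= /split_arc /cap_arc !xpair_eqE /=.
    by rewrite !andbF.
  by rewrite !andbT andbb.
have capi u : count (fun e => e.2 == (phi u, true)) K = c u.
  apply: eq_in_count => x /KR /Rcase [[e ->]|[w ->]]; rewrite /= /split_arc /cap_arc !xpair_eqE /=.
    by rewrite !andbF.
  by rewrite !andbT andbb.
have cq u : (c u <= q u)%N.
  apply: leq_trans (HK _) _; rewrite /R count_cat count_cap (bigD1 u) //= eqxx mul1n.
  rewrite big1 => [|w wu]; last first.
    by rewrite (_ : (cap_arc w == cap_arc u) = false) //; apply: contraNF wu => /eqP [/phi_inj ->].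
  rewrite (_ : count _ _ = 0%N) ?addn0 //; apply/eqP; rewrite -leqn0 leqNgt -has_count.
  by apply/hasPn => x /mapP [e _ ->]; apply/eqP.
have bal u (d : bool) : (u, d) != (s, true) -> (u, d) != (v, false) ->
    count (fun e => e.1 == (phi u, d)) K = count (fun e => e.2 == (phi u, d)) K.
  move=> n1 n2; have := Hb (phi u, d); rewrite /netout.
  have -> : ((phi u, d) == (phi s, true)) = false.
    by apply: contraNF n1 => /eqP [/phi_inj -> ->].
  have -> : ((phi u, d) == (phi v, false)) = false.
    by apply: contraNF n2 => /eqP [/phi_inj -> ->].
  by rewrite subrr mulr0 => /eqP; rewrite subr_eq0 => /eqP [].
exists f; first split.
- by move=> e; rewrite /f; case: (nth _ _ _).
- move=> u us uv; rewrite inE outE.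
  rewrite -(bal u false) ?xpair_eqE ?andbF ?(negbTE uv) // capo.
  by rewrite (bal u true) ?xpair_eqE ?andbF ?(negbTE us) // capi ler_nat.
(* Flow returning to [s] passes its capacity arcs: the inflow is [c s], which cancels from the
   outflow [m + c s]. *)
- rewrite /flow_value outE inE -(bal s false) ?xpair_eqE ?andbF ?(negbTE sv) // capo.
  have := Hb (phi s, true); rewrite /netout capi eqxx xpair_eqE andbF subr0 mulr1.
  move=> /(canRL (subrK _)) h.
  have : count (fun e => e.1 == (phi s, true)) K = (m + c s)%N by apply/eqP; rewrite -eqz_nat h PoszD.
  by move=> ->; rewrite natrD addrK.
Qed.

Lemma lambda_maxflow : is_lambda E q s v m%:R.
Proof.
split; last exact: flow_value_le.
by have [f ? ?] := flow_exists; exists f.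
Qed.

Lemma lambda_geE d : lambda_ge E q s v d <-> (d <= m)%N.
Proof.
split; last by move=> dm; exists m%:R; [exact: lambda_maxflow | rewrite ler_nat].
case=> l [[f [ff <-]] _] dl; rewrite -(@ler_nat rat).
exact: le_trans dl (flow_value_le ff).
Qed.

End Split.

(** * From the greedy list to a set of indices, common to the three problems *)

Section Core.

Variables (N : network) (k : nat) (itm : 'I_k -> item) (a : node) (c : 'I_k -> rat).
Hypothesis Dneq : forall d : demand, d \in N.2 -> d.1.1 != d.1.2.
Hypothesis itm_idx : forall i, (itm i).1 = i.
Hypothesis star : forall i (e : arc), e \in (itm i).2.1 -> e.1 = a.
Hypothesis den_gt0 : forall i, 0 < (itm i).2.2.2.
Hypothesis priceE : forall i, price (itm i) = c i.

Let items := [seq itm i | i <- enum 'I_k].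

Definition chosen : {set 'I_k} := [set i : 'I_k | (i : nat) \in [seq x.1 | x <- greedy N items]].

Definition setcov (S : {set 'I_k}) : nat :=
  coverage N.2 (N.1 ++ flatten [seq (itm i).2.1 | i <- enum S]).

Definition full : nat := \sum_(d <- N.2) d.2.

Lemma itm_inj : injective itm.
Proof. by move=> i j E; apply: val_inj; rewrite /= -!itm_idx E. Qed.

Lemma items_uniq : uniq [seq x.1 | x <- items].
Proof.
rewrite -map_comp map_inj_uniq ?enum_uniq // => i j /=.
by rewrite !itm_idx; exact: val_inj.
Qed.

Lemma items_star (x : item) (e : arc) : x \in items -> e \in x.2.1 -> e.1 = a.
Proof. by case/mapP => i _ ->; exact: star. Qed.

Lemma items_den (x : item) : x \in items -> 0 < x.2.2.2.
Proof. by case/mapP => i _ ->. Qed.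

Lemma set_items S : uniq [seq itm i | i <- enum (S : {set 'I_k})] /\
  {subset [seq itm i | i <- enum S] <= items}.
Proof.
split; first by rewrite map_inj_uniq ?enum_uniq //; exact: itm_inj.
by move=> x /mapP [i _ ->]; rewrite map_f // mem_enum.
Qed.

Lemma setcovE S : setcov S = cov N [seq itm i | i <- enum S].
Proof. by rewrite /setcov /cov -map_comp. Qed.

Lemma greedy_perm : perm_eq (greedy N items) [seq itm i | i <- enum chosen].
Proof.
have gU := greedy_uniq N items_den; have gS := greedy_sub (N := N) items_den.
apply: uniq_perm => //; first by case: (set_items chosen).
move=> x; apply/idP/mapP => [xg|[i]].
  have /mapP [i _ xi] := gS _ xg; exists i => //.
  by rewrite mem_enum inE -itm_idx -xi map_f.
rewrite mem_enum inE => /mapP [y yg iy] ->.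
have /mapP [j _ yj] := gS _ yg; rewrite yj itm_idx in iy.
by rewrite (val_inj iy) -yj.
Qed.

Lemma chosen_full S : setcov S = full -> setcov chosen = full.
Proof.
rewrite !setcovE => SF; apply/eqP; rewrite eqn_leq cov_le /=.
have [u s] := set_items S.
rewrite -SF (leq_trans (greedy_covers Dneq items_star items_uniq items_den u s)) //.
by apply: cov_mono => // x; rewrite (permP greedy_perm).
Qed.

Lemma chosen0 : setcov set0 = full -> chosen = set0.
Proof.
rewrite setcovE enum_set0 /= => E.
suff g0 : greedy N items = [::] by apply/setP => i; rewrite !inE g0.
rewrite /greedy; elim: {2}items => //= x l IH.
have -> : pick N items [::] = [::]; last by [].
rewrite /pick; case C : (cands N items [::]) => [//|y r].
have : y \in cands N items [::] by rewrite C mem_head.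
by rewrite mem_filter E ltnNge cov_le andbF.
Qed.

(** If no single item gained anything, no set could improve on the empty one. Positivity of [K]
    gives [1 <= H K]. *)
Lemma full_gt0 S K : (forall i, gain N [::] (itm i) <= K) ->
  setcov S = full -> setcov set0 <> full -> 0 < K.
Proof.
move=> gK SF n0; rewrite lt0n; apply/eqP => K0; apply: n0.
apply/eqP; rewrite !setcovE enum_set0 /= in SF *.
rewrite eqn_leq cov_le -SF /=; have [u s] := set_items S.
apply: leq_trans (cov_sub_le Dneq items_star items_uniq [::] u s) _.
rewrite big_map big1 ?addn0 // => i _; apply/eqP; rewrite -leqn0 -K0; exact: gK.
Qed.

Lemma core_ratio S K : (forall i, gain N [::] (itm i) <= K) -> setcov S = full ->
  (\sum_(i in chosen) c i <= H K * \sum_(i in S) c i)%R.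
Proof.
move=> gK SF; have [u s] := set_items S; rewrite setcovE in SF.
have toc (A : {set 'I_k}) : (\sum_(i in A) c i = \sum_(x <- [seq itm i | i <- enum A]) price x)%R.
  by rewrite big_map -big_enum; apply: eq_bigr => i _; rewrite priceE.
rewrite !toc -(perm_big _ greedy_perm) /=.
apply: (greedy_ratio Dneq items_star items_uniq items_den u s SF) => y /mapP [i _ ->].
exact: gK.
Qed.

Lemma gain_le i : gain N [::] (itm i) <= \sum_(d <- N.2) minn d.2 (size (itm i).2.1).
Proof.
rewrite leq_subLR /cov /= cats0.
by have := coverage_cat_le Dneq N.1 (itm i).2.1; rewrite cats0.
Qed.

End Core.

(** * The algorithms on encoded instances *)

Notation edges := (seq (nat * nat)).
Notation rawrat := ((bool * nat) * (bool * nat))%type.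
Notation rawsna := (nat * (edges * (seq nat * (nat * (edges * seq ((nat * nat) * nat))))))%type.
Notation rawssl := (nat * (edges * (seq rawrat * (seq nat * (seq nat * seq nat)))))%type.

Definition raw_arc (e : nat * nat) : arc := ((e.1, true), (e.2, false)).

(** For [M = iota 0 k] this has [minn m k] entries, obtained without unrolling the binary number
    [m]. *)
Definition trunc (M : seq nat) (m : nat) : seq nat := [seq j <- M | j < m].

Definition raw_caps (M q : seq nat) : seq arc :=
  flatten [seq [seq ((u.1, false), (u.1, true)) | _ <- trunc M u.2] | u <- zip (iota 0 (size q)) q].

Definition raw_net (x : rawsna) : network :=
  ([seq raw_arc e | e <- x.2.1] ++
     raw_caps (iota 0 (size (x.2.1 ++ x.2.2.2.2.1))) x.2.2.1,
   [seq (((d.1.1, true), (d.1.2, false)), d.2) | d <- x.2.2.2.2.2]).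

Definition raw_edge_items (F : edges) (c : seq rawrat) : seq item :=
  [seq (y.1, ([:: raw_arc y.2.1], (y.2.2.1.2, y.2.2.2.2))) | y <- zip (iota 0 (size F)) (zip F c)].

Definition raw_node_items (a : nat) (F : edges) (c : seq rawrat) : seq item :=
  [seq (y.1, ([seq raw_arc e | e <- [seq e <- F | e.2 == y.1]],
              if y.1 == a then (0, 1) else (y.2.1.2, y.2.2.2)))
     | y <- zip (iota 0 (size c)) c].

Definition marks (A : seq item) (s : seq nat) : seq bool :=
  [seq i \in [seq x.1 | x <- A] | i <- s].

Definition alg_edge (x : rawsna * seq rawrat) : seq bool :=
  marks (greedy (raw_net x.1) (raw_edge_items x.1.2.2.2.2.1 x.2)) (iota 0 (size x.1.2.2.2.2.1)).

(** Items are nodes but the answer is a set of edges: an edge is marked when the item of its head is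
    chosen. *)
Definition alg_node (x : rawsna * seq rawrat) : seq bool :=
  marks (greedy (raw_net x.1) (raw_node_items x.1.2.2.2.1 x.1.2.2.2.2.1 x.2))
    [seq e.2 | e <- x.1.2.2.2.2.1].

(* [M] is the truncation bound; a demand of at least [M] forces [v] to be chosen,
   which then supplies [p] of it directly, [minn p M] after truncation. *)
Definition ssl_demand (M d p : nat) : nat := if d < M then d else minn p M + (d - p).

(** The number of vertices [x.1], being the first number that is not a vertex, names the new source.
    The dummy edge [(0, 0)] turns the number of edges into that number plus one. *)
Definition raw_ssl_net (x : rawssl) : network :=
  ([seq raw_arc e | e <- x.2.1] ++ raw_caps (iota 0 (size ((0, 0) :: x.2.1))) x.2.2.2.2.1,
   [seq (((x.1, true), (y.1, false)), ssl_demand (size ((0, 0) :: x.2.1)) y.2.1 y.2.2)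
      | y <- zip (iota 0 (size x.2.2.2.1)) (zip x.2.2.2.1 x.2.2.2.2.2)]).

Definition raw_ssl_items (x : rawssl) : seq item :=
  [seq (y.1, ([seq ((x.1, true), (y.1, false)) | _ <- trunc (iota 0 (size ((0, 0) :: x.2.1))) y.2.2],
              (y.2.1.1.2, y.2.1.2.2)))
     | y <- zip (iota 0 (size x.2.2.1)) (zip x.2.2.1 x.2.2.2.2.2)].

Definition alg_ssl (x : rawssl) : seq bool :=
  marks (greedy (raw_ssl_net x) (raw_ssl_items x)) (iota 0 (size x.2.2.1)).

(** * Polynomial running time of the algorithms on raw data *)

Section Poly.
Context {T : Type} {eT : enc T}.

Lemma poly_raw_caps (M q : T -> seq nat) : poly M -> poly q -> poly (fun t => raw_caps (M t) (q t)).
Proof.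
move=> pM pq; apply: (poly_call (h := fun p : seq nat * seq nat => raw_caps p.1 p.2)
  (f := fun t => (M t, q t))); last by polyt.
by rewrite /raw_caps /trunc; polyt.
Qed.

Lemma poly_marks (A : T -> seq item) (s : T -> seq nat) :
  poly A -> poly s -> poly (fun t => marks (A t) (s t)).
Proof.
move=> pA ps; apply: (poly_call (h := fun p : seq item * seq nat => marks p.1 p.2)
  (f := fun t => (A t, s t))); last by polyt.
by rewrite /marks; polyt.
Qed.

End Poly.

Lemma poly_raw_net : poly raw_net.
Proof. by rewrite /raw_net /raw_arc; polyt; apply: poly_raw_caps; polyt. Qed.

Lemma poly_alg_edge : poly alg_edge.
Proof.
rewrite /alg_edge; apply: poly_marks; last by polyt.
apply: poly_greedy; first by apply: (poly_call poly_raw_net); polyt.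
by rewrite /raw_edge_items /raw_arc; polyt.
Qed.

Lemma poly_alg_node : poly alg_node.
Proof.
rewrite /alg_node; apply: poly_marks; last by polyt.
apply: poly_greedy; first by apply: (poly_call poly_raw_net); polyt.
by rewrite /raw_node_items /raw_arc; polyt.
Qed.

Lemma poly_alg_ssl : poly alg_ssl.
Proof.
rewrite /alg_ssl; apply: poly_marks; last by polyt.
apply: poly_greedy.
  rewrite /raw_ssl_net /raw_arc /ssl_demand; polyt.
  by apply: poly_raw_caps; polyt.
by rewrite /raw_ssl_items /trunc; polyt.
Qed.

(** * SNA *)

Lemma poly_time_approx_intro (P : min_problem) (ratio : instance P -> rat)
    (f : instance P -> seq bool) :
  @poly _ _ (@enc_instance P) _ f ->
  (forall x, (exists S : solution x, feasible S) -> exists S : solution x,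
     [/\ encode (f x) = enc_solution S, feasible S
       & forall S' : solution x, feasible S' -> (cost S <= ratio x * cost S')%R]) ->
  poly_time_approx ratio.
Proof.
case=> p g [C [k gle]] Hp Hf; exists p, C, k => x.
have [t ev tle] := Hp x; exists (encode (f x)), t; split=> //.
  exact: leq_trans tle (gle x).
exact: Hf.
Qed.

Lemma enc_seq_map A B (e : B -> tree) (f : A -> B) s :
  enc_seq e (map f s) = enc_seq (e \o f) s.
Proof. by elim: s => //= x s ->. Qed.

Definition raw_edge n (e : 'I_n * 'I_n) : nat * nat := (val e.1, val e.2).

Definition raw_rat (c : rat) : rawrat :=
  (((numq c < 0)%R, `|numq c|%N), ((denq c < 0)%R, `|denq c|%N)).

Lemma enc_edgesE n (E : seq ('I_n * 'I_n)) : encode [seq raw_edge e | e <- E] = enc_edges E.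
Proof. exact: enc_seq_map. Qed.

Lemma enc_fun_natE n (f : 'I_n -> nat) : encode [seq f i | i <- enum 'I_n] = enc_fun enc_nat f.
Proof. by []. Qed.

Lemma enc_fun_ratE n (f : 'I_n -> rat) :
  encode [seq raw_rat (f i) | i <- enum 'I_n] = enc_fun enc_rat f.
Proof. by rewrite /enc_fun (map_comp raw_rat f) /encode /enc_s enc_seq_map. Qed.

Lemma size_trunc M m : size (trunc (iota 0 M) m) = minn m M.
Proof.
rewrite /trunc size_filter; elim: M => [|M IH]; first by rewrite minn0.
by rewrite -addn1 iotaD count_cat IH /= add0n; case: ltnP; lia.
Qed.

Lemma map_trunc A (x : A) M m : [seq x | _ <- trunc (iota 0 M) m] = nseq (minn m M) x.
Proof. by rewrite -size_trunc; elim: (trunc _ _) => //= y s ->. Qed.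

Lemma zip_iota A n (f : 'I_n -> A) :
  zip (iota 0 n) [seq f i | i <- enum 'I_n] = [seq (nat_of_ord i, f i) | i <- enum 'I_n].
Proof. by rewrite -val_enum_ord zip_map. Qed.

Lemma raw_capsE n M (q : 'I_n -> nat) :
  raw_caps (iota 0 M) [seq q u | u <- enum 'I_n] =
  cap_arcs (fun u : 'I_n => u : nat) (fun u => minn (q u) M).
Proof.
rewrite /raw_caps size_map size_enum_ord zip_iota /cap_arcs -map_comp.
by congr flatten; apply: eq_map => u /=; exact: map_trunc.
Qed.

Lemma map_edge_enum (V : finType) (F : seq (V * V)) : [seq edge i | i <- enum 'I_(size F)] = F.
Proof. exact: (map_tnth_enum (in_tuple F)). Qed.

Lemma price_rat (c : rat) : (0 <= c)%R ->
  ((`|numq c|%N)%:R / (`|denq c|%N)%:R = c :> rat)%R.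
Proof.
move=> c0; rewrite !natr_absz !ger0_norm ?numq_ge0 ?denq_ge0 //.
exact: divq_num_den.
Qed.

(* A flow never exceeds the number of edges at a node, so truncating the
   capacities at any such bound is harmless. *)
Lemma lambda_ge_minn (V : finType) (E : seq (V * V)) (q : V -> nat) s v d M : size E <= M ->
  lambda_ge E q s v d <-> lambda_ge E (fun u => minn (q u) M) s v d.
Proof.
move=> EM; suff isf f : is_flow (E := E) q s v f <-> is_flow (fun u => minn (q u) M) s v f.
  by split=> -[l [[f [ff fl]] mx] dl]; exists l => //; (split; first by exists f; split=> //; apply/isf);
    move=> g /isf; exact: mx.
split=> -[f01 fc]; split=> // u us uv; have [e1 e2] := fc u us uv; split=> //.
  case: (leqP (q u) M) => _ //; apply: (@le_trans _ _ (size E)%:R%R); last by rewrite ler_nat.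
  apply: (@le_trans _ _ (\sum_(e < size E) 1)%R); last by rewrite sumr_const card_ord.
  rewrite /inflow big_mkcond; apply: ler_sum => e _.
  by case: ifP => // _; have /andP [] := f01 e.
by apply: le_trans e2 _; rewrite ler_nat geq_minl.
Qed.

Section SNA.
Variable x : sna.

Let phi (u : 'I_(sna_n x)) : nat := u.
Let M := size (sna_E x) + size (sna_F x).

Definition raw_sna : rawsna :=
  (sna_n x, ([seq raw_edge e | e <- sna_E x], ([seq sna_q u | u <- enum 'I_(sna_n x)],
   (nat_of_ord (sna_a x), ([seq raw_edge e | e <- sna_F x],
   [seq (raw_edge sv, sna_r sv) | sv <- enum (sna_D x)]))))).

Lemma enc_snaE : encode raw_sna = enc_sna x.
Proof.
have L : encode [seq (raw_edge sv, sna_r sv) | sv <- enum (sna_D x)] =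
    enc_seq (enc_pair (enc_pair (@enc_ord _) (@enc_ord _)) enc_nat)
            [seq (sv, sna_r sv) | sv <- enum (sna_D x)].
  by rewrite /encode /enc_s !enc_seq_map.
by rewrite /enc_sna -L -!enc_edgesE -enc_fun_natE.
Qed.

Definition sna_base : seq arc :=
  [seq split_arc phi e | e <- sna_E x] ++ cap_arcs phi (fun u => minn (sna_q u) M).

Definition sna_demands : seq demand :=
  [seq (((nat_of_ord sv.1, true), (nat_of_ord sv.2, false)), sna_r sv) | sv <- enum (sna_D x)].

Definition sna_net : network := (sna_base, sna_demands).

Lemma raw_netE : raw_net raw_sna = sna_net.
Proof.
rewrite /raw_net /= /sna_net /sna_base /sna_demands size_cat !size_map raw_capsE -!map_comp.
by congr pair; congr cat; apply: eq_map.
Qed.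

Lemma sna_demands_neq (d : demand) : d \in sna_net.2 -> d.1.1 != d.1.2.
Proof. by case/mapP => sv _ ->; rewrite xpair_eqE andbF. Qed.

(** Feasibility depends on the cuts only, so [R] may list the chosen edges in whatever order the
    items produce them. At most [M] edges are ever present, which justifies the truncated
    capacities. *)
Lemma sna_feasibleE (I : {set 'I_(size (sna_F x))}) R :
  (forall X, cut X R = cut X (sna_base ++ map (split_arc phi) (sna_edges I))) ->
  sna_feasible I <-> coverage sna_net.2 R = \sum_(d <- sna_net.2) d.2.
Proof.
move=> cR; have szE : size (sna_E x ++ sna_edges I) <= M.
  by rewrite size_cat size_map -cardE leq_add2l; have := max_card (mem I); rewrite card_ord.
have key s v : (s, v) \in sna_D x ->
    lambda_ge (sna_E x ++ sna_edges I) (@sna_q x) s v (sna_r (s, v)) <->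
    sna_r (s, v) <= maxflow (phi s, true) (phi v, false) R.
  move=> svD; rewrite (lambda_ge_minn _ _ _ _ szE).
  rewrite (lambda_geE (phi := phi) (@ord_inj _)) ?(sna_D_neq svD) //.
  set m1 := maxflow _ _ _; suff -> : m1 = maxflow (phi s, true) (phi v, false) R by [].
  apply/eqP; rewrite eqn_leq /m1 !maxflow_mono ?xpair_eqE ?andbF // => X;
    by rewrite cR /sna_base map_cat !cut_cat addnAC.
split=> [fe|/eqP].
  apply/eqP; rewrite coverage_full; apply/allP => d /mapP [[s v] svD ->] /=.
  by apply/key; [rewrite -mem_enum | apply: fe; rewrite -mem_enum].
rewrite coverage_full => /allP al s v svD; apply/key => //.
by apply: (al ((phi s, true, (phi v, false)), sna_r (s, v))); apply/mapP; exists (s, v); rewrite ?mem_enum.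
Qed.

Lemma cut_sna_edges X (I : {set 'I_(size (sna_F x))}) :
  cut X (map (split_arc phi) (sna_edges I)) = \sum_(i in I) cut X [:: split_arc phi (edge i)].
Proof.
rewrite -big_enum /= /sna_edges; elim: (enum I) => [|i s IH]; first by rewrite big_nil.
by rewrite big_cons -IH /cut /= addn0.
Qed.

Lemma edge_tail (i : 'I_(size (sna_F x))) : (edge i).1 = sna_a x.
Proof. by apply: sna_F_from_a; exact: mem_tnth. Qed.

End SNA.

Lemma marks_chosen N k (itm : 'I_k -> item) :
  encode (marks (greedy N [seq itm i | i <- enum 'I_k]) (iota 0 k)) = enc_set (chosen N itm).
Proof.
congr enc_seq; rewrite /marks -val_enum_ord -map_comp.
by apply: eq_map => i; rewrite /= inE.
Qed.

Lemma cut_flatten X A (f : A -> seq arc) (s : seq A) :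
  cut X (flatten [seq f a | a <- s]) = \sum_(a <- s) cut X (f a).
Proof. by rewrite /cut count_flatten sumnE !big_map. Qed.

(** * SNA with edge-costs: one item for each edge *)

Section EdgeCosts.
Variable x : sna_ec.

Definition edge_item (i : 'I_(size (sna_F x))) : item :=
  (nat_of_ord i, ([:: split_arc (@nat_of_ord _) (edge i)],
                  (`|numq (ec_c i)|%N, `|denq (ec_c i)|%N))).

Definition raw_ec : rawsna * seq rawrat :=
  (raw_sna x, [seq raw_rat (ec_c i) | i <- enum 'I_(size (sna_F x))]).

Lemma enc_ecE : encode raw_ec = enc_instance (m := sna_edge_costs) x.
Proof.
have -> : encode raw_ec = Node (encode (raw_sna x))
  (encode [seq raw_rat (ec_c i) | i <- enum 'I_(size (sna_F x))]) by [].
by rewrite enc_snaE enc_fun_ratE.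
Qed.

Lemma raw_edge_itemsE :
  raw_edge_items raw_ec.1.2.2.2.2.1 raw_ec.2 =
  [seq edge_item i | i <- enum 'I_(size (sna_F x))].
Proof.
rewrite /raw_edge_items /= size_map.
have -> : [seq raw_edge e | e <- sna_F x] =
    [seq raw_edge (edge i) | i <- enum 'I_(size (sna_F x))].
  by rewrite [RHS](map_comp (@raw_edge _)) map_edge_enum.
by rewrite zip_map zip_iota -map_comp.
Qed.

Lemma edge_item_idx i : (edge_item i).1 = i.
Proof. by []. Qed.

Lemma edge_item_star i (e : arc) : e \in (edge_item i).2.1 -> e.1 = (nat_of_ord (sna_a x), true).
Proof. by rewrite inE => /eqP ->; rewrite /= edge_tail. Qed.

Lemma edge_item_den i : 0 < (edge_item i).2.2.2.
Proof. by rewrite /= absz_gt0 denq_neq0. Qed.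

Lemma edge_item_price i : price (edge_item i) = ec_c i.
Proof. by apply: price_rat; exact: ec_c_ge0. Qed.

Lemma edge_feasible (I : {set 'I_(size (sna_F x))}) :
  sna_feasible I <-> setcov (sna_net x) edge_item I = full (sna_net x).
Proof.
apply: sna_feasibleE => X; rewrite !cut_cat cut_sna_edges; congr addn.
by rewrite cut_flatten -big_enum.
Qed.

End EdgeCosts.

Lemma sna_edge_costs_approx :
  poly_time_approx (P := sna_edge_costs) (fun x : sna_ec => H #|sna_D x|).
Proof.
apply: (@poly_time_approx_intro sna_edge_costs _ (fun x : sna_ec => alg_edge (raw_ec x))).
  apply: (@poly_call _ (@enc_instance sna_edge_costs) _ _ _ _ _ _ poly_alg_edge).
  by apply: poly_recode => x; exact: enc_ecE.
move=> /= x [S0 S0f]; exists (chosen (sna_net x) (@edge_item x)).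
have F0 := (edge_feasible S0).1 S0f.
have neq := @sna_demands_neq x; have star := @edge_item_star x.
have idx := @edge_item_idx x; have den := @edge_item_den x.
split.
- rewrite -marks_chosen /alg_edge raw_edge_itemsE raw_netE; congr (encode (marks _ (iota 0 _))).
  by rewrite /= size_map.
- by apply/edge_feasible; exact: (chosen_full neq idx star den F0).
- have gK (i : 'I_(size (sna_F x))) : gain (sna_net x) [::] (edge_item i) <= #|sna_D x|.
    apply: leq_trans (@gain_le (sna_net x) _ (@edge_item x) neq i) _.
    apply: (@leq_trans (\sum_(d <- (sna_net x).2) 1)).
      by apply: leq_sum => d _; rewrite geq_minr.
    by rewrite sum1_size size_map -cardE.
  by move=> S /edge_feasible; exact: (core_ratio neq idx star den (@edge_item_price x) gK).
Qed.

(** * SNA with node-costs: one item for each head *)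

Section NodeCosts.
Variable x : sna_nc.

Definition node_item (u : 'I_(sna_n x)) : item :=
  (nat_of_ord u, ([seq split_arc (@nat_of_ord _) e | e <- sna_F x & e.2 == u],
    if u == sna_a x then (0, 1) else (`|numq (nc_c u)|%N, `|denq (nc_c u)|%N))).

Definition node_price (u : 'I_(sna_n x)) : rat := if u == sna_a x then 0%R else nc_c u.

Definition raw_nc : rawsna * seq rawrat :=
  (raw_sna x, [seq raw_rat (nc_c u) | u <- enum 'I_(sna_n x)]).

Lemma enc_ncE : encode raw_nc = enc_instance (m := sna_node_costs) x.
Proof.
have -> : encode raw_nc = Node (encode (raw_sna x))
  (encode [seq raw_rat (nc_c u) | u <- enum 'I_(sna_n x)]) by [].
by rewrite enc_snaE enc_fun_ratE.
Qed.

Lemma raw_node_itemsE :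
  raw_node_items raw_nc.1.2.2.2.1 raw_nc.1.2.2.2.2.1 raw_nc.2 =
  [seq node_item u | u <- enum 'I_(sna_n x)].
Proof.
rewrite /raw_node_items /= size_map size_enum_ord zip_iota -map_comp.
apply: eq_map => u; rewrite /node_item /=; congr (_, (_, _)).
by rewrite filter_map -map_comp; congr map.
Qed.

Lemma node_item_idx u : (node_item u).1 = u.
Proof. by []. Qed.

Lemma node_item_star u (e : arc) : e \in (node_item u).2.1 -> e.1 = (nat_of_ord (sna_a x), true).
Proof.
by case/mapP => f; rewrite mem_filter => /andP [_ /sna_F_from_a fa] ->; rewrite /= fa.
Qed.

Lemma node_item_den u : 0 < (node_item u).2.2.2.
Proof. by rewrite /=; case: ifP => //; rewrite /= absz_gt0 denq_neq0. Qed.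

Lemma node_item_price u : price (node_item u) = node_price u.
Proof.
rewrite /price /node_price /=; case: ifP => _ /=; first by rewrite mul0r.
by apply: price_rat; exact: nc_c_ge0.
Qed.

Definition heads (S : {set 'I_(sna_n x)}) : {set 'I_(size (sna_F x))} :=
  [set i | (edge i).2 \in S].

Lemma sna_edges_heads S : sna_edges (heads S) = [seq e <- sna_F x | e.2 \in S].
Proof.
rewrite -[in RHS](map_edge_enum (sna_F x)) filter_map /sna_edges; congr map.
by rewrite {1}/enum_mem -enumT; apply: eq_filter => i; rewrite /= inE.
Qed.

Lemma cut_node_items X (S : {set 'I_(sna_n x)}) :
  cut X (flatten [seq (node_item u).2.1 | u <- enum S]) =
  cut X (map (split_arc (@nat_of_ord _)) (sna_edges (heads S))).
Proof.
rewrite sna_edges_heads cut_split.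
have -> : cut X (flatten [seq (node_item u).2.1 | u <- enum S]) =
    \sum_(u in S) cut X (node_item u).2.1.
  by rewrite cut_flatten -big_enum.
under eq_bigr do rewrite /node_item /= cut_split count_filter.
rewrite count_filter; elim: (sna_F x) => [|e F IH] /=; first by rewrite big1.
rewrite big_split /= IH; congr addn.
set b := _ && _; case: (boolP (e.2 \in S)) => eS; last first.
  rewrite andbF big1 // => u uS; rewrite [e.2 == u](_ : _ = false) ?andbF //.
  by apply: contraNF eS => /eqP ->.
rewrite (bigD1 e.2) //= eqxx andbT big1 ?addn0 // => u /andP [_ ue].
by rewrite eq_sym (negbTE ue) andbF.
Qed.

Lemma node_feasible (S : {set 'I_(sna_n x)}) :
  sna_feasible (heads S) <-> setcov (sna_net x) node_item S = full (sna_net x).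
Proof. by apply: sna_feasibleE => X; rewrite !cut_cat cut_node_items. Qed.

Definition head_set (I : {set 'I_(size (sna_F x))}) : {set 'I_(sna_n x)} :=
  [set (edge i).2 | i in I].

(** Adding all further edges into the heads of [I] only enlarges cuts, so solutions may be assumed
    to be of the form [heads S]. *)
Lemma head_set_feasible (I : {set 'I_(size (sna_F x))}) : sna_feasible I ->
  setcov (sna_net x) node_item (head_set I) = full (sna_net x).
Proof.
move=> /sna_feasibleE SF; apply/eqP; rewrite eqn_leq coverage_le /= -[X in X <= _](SF _ (fun=> erefl)).
apply: coverage_mono; first exact: sna_demands_neq.
move=> X; rewrite !cut_cat leq_add2l cut_node_items !cut_sna_edges.
rewrite [X in _ <= X](big_setID I) /= (_ : heads (head_set I) :&: I = I) ?leq_addr //.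
by apply/setIidPr/subsetP => i iI; rewrite inE; exact: (imset_f (fun i => (edge i).2)).
Qed.

Lemma node_gain_le (u : 'I_(sna_n x)) :
  gain (sna_net x) [::] (node_item u) <= minn (sna_rD x) (#|sna_D x| * sna_pmax x).
Proof.
have sz : size (node_item u).2.1 <= sna_pmax x.
  rewrite /= size_map size_filter; have [->//|] := posnP (count (fun e => e.2 == u) (sna_F x)).
  rewrite -has_count => /hasP [e eF /eqP eu].
  (* Edges of [F] into [u] share their tail as well, hence are parallel. *)
  have -> : count (fun e => e.2 == u) (sna_F x) = count_mem e (sna_F x).
    apply: eq_in_count => f fF /=; rewrite -eu -[f == e]/((f.1 == e.1) && (f.2 == e.2)).
    by rewrite !sna_F_from_a // eqxx.
  exact: leq_bigmax_seq.
apply: leq_trans (@gain_le (sna_net x) _ node_item (@sna_demands_neq x) u) _; rewrite leq_min; apply/andP; split.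
  rewrite /sna_rD -big_enum /= big_map; apply: leq_sum => sv _; exact: geq_minl.
apply: (@leq_trans (\sum_(d <- (sna_net x).2) sna_pmax x)).
  by apply: leq_sum => d _; apply: leq_trans sz; exact: geq_minr.
by rewrite big_const_seq count_predT iter_addn_0 size_map -cardE mulnC.
Qed.

End NodeCosts.

Lemma sna_node_costs_approx :
  poly_time_approx (P := sna_node_costs)
    (fun x : sna_nc => H (minn (sna_rD x) (#|sna_D x| * sna_pmax x))).
Proof.
apply: (@poly_time_approx_intro sna_node_costs _ (fun x : sna_nc => alg_node (raw_nc x))).
  apply: (@poly_call _ (@enc_instance sna_node_costs) _ _ _ _ _ _ poly_alg_node).
  by apply: poly_recode => x; exact: enc_ncE.
move=> /= x [S0 S0f]; set C := chosen (sna_net x) (@node_item x); exists (heads C).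
have F0 := head_set_feasible S0f.
have neq := @sna_demands_neq x; have star := @node_item_star x.
have idx := @node_item_idx x; have den := @node_item_den x.
split.
- rewrite /alg_node raw_node_itemsE raw_netE.
  have -> : [seq e.2 | e <- (raw_nc x).1.2.2.2.2.1] =
      [seq nat_of_ord (edge i).2 | i <- enum 'I_(size (sna_F x))].
    transitivity [seq nat_of_ord e.2 | e <- sna_F x]; first by rewrite /= -map_comp.
    by rewrite -[in LHS](map_edge_enum (sna_F x)) -map_comp.
  rewrite /marks -[in LHS]map_comp; congr enc_seq.
  by apply: eq_map => i; rewrite /= inE /C inE.
- by apply/node_feasible; exact: (chosen_full neq idx star den F0).
move=> I If; have IF := head_set_feasible If.
have c0 := @nc_c_ge0 x; rewrite /cost /=.
have costge (A : {set 'I_(sna_n x)}) : (0 <= \sum_(u in A) nc_c u)%R by apply: sumr_ge0.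
have [E|nE] := eqVneq (setcov (sna_net x) (@node_item x) set0) (full (sna_net x)).
  have -> : heads C = set0 by rewrite /C (chosen0 E); apply/setP => i; rewrite !inE.
  by rewrite /endnodes !imset0 setU0 big_set0 mulr_ge0 ?H_ge0.
set K := minn _ _; have gK u := node_gain_le (x := x) u.
have K0 : 0 < K by apply: (full_gt0 neq idx star gK IF); apply/eqP.
have ratio := core_ratio neq idx star den (@node_item_price x) gK IF.
have split_cost (A : {set 'I_(sna_n x)}) :
    (\sum_(u in sna_a x |: A) nc_c u = nc_c (sna_a x) + \sum_(u in A) node_price u)%R.
  rewrite (bigD1 (sna_a x)) ?setU11 //=; congr (_ + _)%R.
  rewrite [RHS](big_mkcond) [LHS]big_mkcond; apply: eq_bigr => u _.
  by rewrite /node_price !inE; case: eqP => //=; rewrite ?if_same ?andbF ?andbT.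
have endI : endnodes I = sna_a x |: head_set I.
  have [I0|[i iI]] := set_0Vmem I.
    by case/eqP: nE; rewrite -IF I0 /head_set imset0.
  rewrite /endnodes; congr (_ :|: _); apply/setP => u; rewrite inE.
  by apply/imsetP/eqP => [[j _ ->]|->]; [exact: edge_tail | exists i; rewrite ?edge_tail].
rewrite endI split_cost.
(* The inclusion of [endnodes (heads C)] in [sna_a x |: C] suffices, as costs are nonnegative. *)
apply: (@le_trans _ _ (\sum_(u in sna_a x |: C) nc_c u)%R).
  apply: (@le_trans _ _ (\sum_(u in sna_a x |: C | u \in endnodes (heads C)) nc_c u)%R); last first.
    by rewrite big_mkcondr; apply: ler_sum => u _; case: ifP.
  rewrite le_eqVlt; apply/orP; left; apply/eqP; apply: eq_bigl => u.
  case: (boolP (u \in endnodes _)); rewrite ?andbF // andbT inE => /orP [] /imsetP [i].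
    by move=> _ ->; rewrite edge_tail setU11.
  by rewrite inE => iC ->; rewrite inE iC orbT.
rewrite split_cost mulrDr lerD // ler_peMl ?c0 //; exact: H_ge1.
Qed.

(** * SSL *)

Lemma sum_option (T : finType) (F : option T -> nat) :
  \sum_u F u = F None + \sum_u F (Some u).
Proof.
rewrite (bigD1 None) //=; congr addn.
by rewrite (reindex_omap Some id) //=; [apply: eq_bigl => u; rewrite eqxx | case].
Qed.

Lemma sum_in_split (T : finType) (S : {set T}) v (F : T -> nat) :
  \sum_(u in S) F u = (v \in S) * F v + \sum_(u in S | u != v) F u.
Proof.
have [vS|vS] := boolP (v \in S); first by rewrite (bigD1 v) //= mul1n.
rewrite mul0n add0n; apply: eq_bigl => u.
by case: (eqVneq u v) => [->|]; rewrite ?(negbTE vS) ?andbT.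
Qed.

Section SSL.
Variable x : ssl.

Definition ssl_cap : nat := (size (ssl_E x)).+1.

Definition ssl_tq (u : 'I_(ssl_n x)) : nat := minn (ssl_q u) ssl_cap.
Definition ssl_tp (u : 'I_(ssl_n x)) : nat := minn (ssl_p u) ssl_cap.

Definition ssl_id (u : option 'I_(ssl_n x)) : nat := if u is Some w then nat_of_ord w else ssl_n x.

Lemma ssl_id_inj : injective ssl_id.
Proof.
move=> [u|] [v|] //= E; first by congr Some; exact: val_inj.
  by have := ltn_ord u; rewrite E ltnn.
by have := ltn_ord v; rewrite -E ltnn.
Qed.

Let src : node := (ssl_n x, true).

Definition ssl_base : seq arc :=
  [seq split_arc (@nat_of_ord _) e | e <- ssl_E x] ++
  cap_arcs (@nat_of_ord _) ssl_tq.

Definition ssl_demands : seq demand :=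
  [seq ((src, (nat_of_ord v, false)), ssl_demand ssl_cap (ssl_d v) (ssl_p v))
     | v <- enum 'I_(ssl_n x)].

Definition ssl_net : network := (ssl_base, ssl_demands).

Definition ssl_item (u : 'I_(ssl_n x)) : item :=
  (nat_of_ord u, (nseq (ssl_tp u) (src, (nat_of_ord u, false)),
    (`|numq (ssl_c u)|%N, `|denq (ssl_c u)|%N))).

Definition raw_ssl : rawssl :=
  (ssl_n x, ([seq raw_edge e | e <- ssl_E x], ([seq raw_rat (ssl_c u) | u <- enum 'I_(ssl_n x)],
   ([seq ssl_d u | u <- enum 'I_(ssl_n x)], ([seq ssl_q u | u <- enum 'I_(ssl_n x)],
    [seq ssl_p u | u <- enum 'I_(ssl_n x)]))))).

Lemma enc_sslE : encode raw_ssl = enc_instance (m := directed_ssl) x.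
Proof. by rewrite /= /enc_ssl -enc_edgesE -enc_fun_ratE -!enc_fun_natE. Qed.

Lemma size_ssl_cap : size ((0, 0) :: [seq raw_edge e | e <- ssl_E x]) = ssl_cap.
Proof. by rewrite /= size_map. Qed.

Lemma raw_ssl_netE : raw_ssl_net raw_ssl = ssl_net.
Proof.
rewrite /raw_ssl_net /ssl_net /ssl_base /ssl_demands /raw_ssl; cbn [fst snd].
rewrite size_ssl_cap size_map size_enum_ord raw_capsE zip_map zip_iota -!map_comp.
by congr pair; congr cat; apply: eq_map.
Qed.

Lemma raw_ssl_itemsE : raw_ssl_items raw_ssl = [seq ssl_item u | u <- enum 'I_(ssl_n x)].
Proof.
rewrite /raw_ssl_items /raw_ssl; cbn [fst snd].
rewrite size_ssl_cap size_map size_enum_ord zip_map zip_iota -!map_comp.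
by apply: eq_map => u; rewrite /comp; cbn [fst snd]; rewrite map_trunc.
Qed.

Lemma ssl_item_idx u : (ssl_item u).1 = u.
Proof. by []. Qed.

Lemma ssl_item_star u (e : arc) : e \in (ssl_item u).2.1 -> e.1 = src.
Proof. by rewrite mem_nseq => /andP [_ /eqP ->]. Qed.

Lemma ssl_item_den u : 0 < (ssl_item u).2.2.2.
Proof. by rewrite /= absz_gt0 denq_neq0. Qed.

Lemma ssl_item_price u : price (ssl_item u) = ssl_c u.
Proof. by apply: price_rat; exact: ssl_c_ge0. Qed.

Lemma ssl_demands_neq (d : demand) : d \in ssl_net.2 -> d.1.1 != d.1.2.
Proof. by case/mapP => v _ ->; rewrite xpair_eqE andbF. Qed.

Section Cuts.
Variables (S : {set 'I_(ssl_n x)}) (v : 'I_(ssl_n x)).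

Definition ssl_arcs : seq arc :=
  map (split_arc ssl_id) (ssl_ext_edges S) ++ cap_arcs ssl_id (@ssl_ext_q x).

Definition ssl_core_arcs : seq arc := ssl_base ++ flatten [seq (ssl_item u).2.1 | u <- enum S].

(* The part of a cut that remains after deleting the arcs from the source
   straight to the target [v], for node capacities [q] and multiplicities [p]. *)
Definition ssl_rest (q p : 'I_(ssl_n x) -> nat) (X : pred node) : nat :=
  cut X [seq split_arc (@nat_of_ord _) e | e <- ssl_E x] +
  \sum_(u < ssl_n x) (X (nat_of_ord u, false) && ~~ X (nat_of_ord u, true)) * q u +
  \sum_(u in S | u != v) ~~ X (nat_of_ord u, false) * p u.

Lemma cut_ssl_arcs (X : pred node) : X src -> ~~ X (nat_of_ord v, false) ->
  cut X ssl_arcs = (v \in S) * ssl_p v + ssl_rest (@ssl_q x) (@ssl_p x) X.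
Proof.
move=> Xs Xv; rewrite /ssl_arcs cut_cat /ssl_ext_edges map_cat cut_cat.
have -> : cut X (cap_arcs ssl_id (@ssl_ext_q x)) =
    \sum_(u < ssl_n x) (X (nat_of_ord u, false) && ~~ X (nat_of_ord u, true)) * ssl_q u.
  by rewrite /cut count_cap sum_option /= muln0.
have -> : cut X [seq split_arc ssl_id i | i <- flatten [seq nseq (ssl_p u) (None, Some u) | u <- enum S]] =
    \sum_(u in S) ~~ X (nat_of_ord u, false) * ssl_p u.
  rewrite map_flatten -map_comp cut_flatten -big_enum /=; apply: eq_bigr => u _.
  by rewrite map_nseq /cut count_nseq /= -/src Xs.
rewrite -map_comp /ssl_rest (sum_in_split S v) Xv mul1n.
rewrite -[cut X (map (_ \o _) _)]/(cut X [seq split_arc (@nat_of_ord _) e | e <- ssl_E x]).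
by rewrite addnCA -addnA addnAC.
Qed.

Lemma cut_ssl_core_arcs (X : pred node) : X src -> ~~ X (nat_of_ord v, false) ->
  cut X ssl_core_arcs = (v \in S) * ssl_tp v +
    ssl_rest ssl_tq ssl_tp X.
Proof.
move=> Xs Xv; rewrite /ssl_core_arcs cut_cat /ssl_base cut_cat.
have -> : cut X (cap_arcs (@nat_of_ord _) ssl_tq) =
    \sum_(u < ssl_n x) (X (nat_of_ord u, false) && ~~ X (nat_of_ord u, true)) * ssl_tq u.
  by rewrite /cut count_cap.
have -> : cut X (flatten [seq (ssl_item u).2.1 | u <- enum S]) =
    \sum_(u in S) ~~ X (nat_of_ord u, false) * ssl_tp u.
  rewrite cut_flatten -big_enum /=; apply: eq_bigr => u _.
  by rewrite /cut count_nseq /= -/src Xs.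
by rewrite /ssl_rest (sum_in_split S v) Xv mul1n addnCA.
Qed.

Lemma ssl_rest_trunc_le X :
  ssl_rest ssl_tq ssl_tp X <=
  ssl_rest (@ssl_q x) (@ssl_p x) X.
Proof.
rewrite /ssl_rest !leq_add //.
  by apply: leq_sum => u _; rewrite leq_mul2l geq_minl orbT.
by apply: leq_sum => u _; rewrite leq_mul2l geq_minl orbT.
Qed.

(** A term that is really truncated and enters the cut would alone contribute [ssl_cap]; below this
    value truncation has no effect. *)
Lemma ssl_rest_le_trunc X :
  ssl_rest ssl_tq ssl_tp X < ssl_cap ->
  ssl_rest (@ssl_q x) (@ssl_p x) X <=
  ssl_rest ssl_tq ssl_tp X.
Proof.
rewrite /ssl_rest => lt; have aux (b : bool) m : b * minn m ssl_cap < ssl_cap -> b * m <= b * minn m ssl_cap.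
  by case: b; rewrite ?mul0n // !mul1n; lia.
rewrite !leq_add //; apply: leq_sum => u Pu; apply: aux; apply: leq_ltn_trans lt.
  rewrite -addnA addnCA -[X in X <= _]addn0 leq_add //.
  by rewrite (bigD1 u) //= leq_addr.
by rewrite (bigD1 u Pu) /= addnCA leq_addr.
Qed.

Lemma ssl_rest_min :
  exists X : pred node, [/\ X src, ~~ X (nat_of_ord v, false)
    & ssl_rest (@ssl_q x) (@ssl_p x) X < ssl_cap].
Proof.
(* Only the entry of [v] is left out, so apart from the direct arcs just the edges of [E] into [v]
   cross this cut. *)
exists (fun w => w != (nat_of_ord v, false)); split=> /=.
- by rewrite xpair_eqE andbF.
- by rewrite eqxx.
rewrite /ssl_rest [X in _ + X]big1 => [|u /andP [_ uv]]; last first.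
  by rewrite xpair_eqE andbT negbK -[_ == _]/(u == v) (negbTE uv).
rewrite big1 => [|u _]; last by rewrite [(_, true) == _]xpair_eqE andbF /= andbF.
by rewrite !addn0 ltnS -(size_map (split_arc (@nat_of_ord _)) (ssl_E x)); exact: count_size.
Qed.

(** Both minimum cuts leave a remainder below [ssl_cap], where truncation is invisible, so the
    remainders agree. The two flow values can differ only in the direct supply of a chosen [v],
    namely [ssl_p v] against [ssl_tp v]. *)
Lemma ssl_demandE :
  (ssl_d v <= maxflow src (nat_of_ord v, false) ssl_arcs) =
  (ssl_demand ssl_cap (ssl_d v) (ssl_p v) <= maxflow src (nat_of_ord v, false) ssl_core_arcs).
Proof.
have neq : src != (nat_of_ord v, false) by rewrite xpair_eqE andbF.
have [H1 [X1 [X1s X1v E1]] _] := maxflow_spec ssl_arcs neq.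
have [H2 [X2 [X2s X2v E2]] _] := maxflow_spec ssl_core_arcs neq.
have [X0 [X0s X0v lt0]] := ssl_rest_min.
have h10 := H1 _ X0s X0v; have h12 := H1 _ X2s X2v; have h21 := H2 _ X1s X1v.
have h20 := H2 _ X0s X0v; have t0 := ssl_rest_trunc_le X0; have t1 := ssl_rest_trunc_le X1.
have t2 := @ssl_rest_le_trunc X2.
rewrite -E1 ?cut_ssl_arcs // in h10 h12 *; rewrite -E2 ?cut_ssl_core_arcs // in h20 h21 *.
rewrite leq_add2l in h10; rewrite leq_add2l in h12.
rewrite leq_add2l in h20; rewrite leq_add2l in h21.
set r1 := ssl_rest _ _ X1 in h10 h12 t1 *; set r2 := ssl_rest _ _ X2 in h20 h21 t2 *.
have r1M : r1 < ssl_cap := leq_ltn_trans h10 lt0.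
have r2M : r2 < ssl_cap := leq_ltn_trans (leq_trans h20 t0) lt0.
have -> : r2 = r1.
  by apply/eqP; rewrite eqn_leq (leq_trans h21 t1) (leq_trans h12 (t2 r2M)).
(* A demand below [M] is met by a truncated direct supply on its own. A demand of at least [M]
   exceeds the remainder [r], so both sides fail without [v] and reduce to [d - p <= r] with it. *)
rewrite /ssl_demand /ssl_tp; move: r1M; clear; move: r1 ssl_cap => r M.
case: (v \in S); rewrite ?mul1n ?mul0n; case: (ltnP (ssl_d v) M); lia.
Qed.

End Cuts.

Lemma ssl_feasibleE (S : {set 'I_(ssl_n x)}) :
  ssl_feasible S <-> setcov ssl_net ssl_item S = full ssl_net.
Proof.
have key v : lambda_ge (ssl_ext_edges S) (@ssl_ext_q x) None (Some v) (ssl_d v) <->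
    ssl_demand ssl_cap (ssl_d v) (ssl_p v) <= maxflow src (nat_of_ord v, false) (ssl_core_arcs S).
  by rewrite (lambda_geE ssl_id_inj) // ssl_demandE.
split=> [fe|/eqP].
  by apply/eqP; rewrite coverage_full; apply/allP => d /mapP [v _ ->]; apply/key.
rewrite coverage_full => /allP al v; apply/key.
by apply: (al ((src, (nat_of_ord v, false)), ssl_demand ssl_cap (ssl_d v) (ssl_p v)));
  apply/mapP; exists v; rewrite ?mem_enum.
Qed.

Lemma ssl_gain_le (u : 'I_(ssl_n x)) :
  gain ssl_net [::] (ssl_item u) <=
  minn (\sum_(v < ssl_n x) ssl_d v) (ssl_n x * \max_(w < ssl_n x) ssl_p w).
Proof.
apply: leq_trans (@gain_le ssl_net _ ssl_item ssl_demands_neq u) _.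
rewrite leq_min big_map big_enum /= size_nseq; apply/andP; split.
  apply: leq_sum => v _; apply: leq_trans (geq_minl _ _) _.
  by rewrite /ssl_demand; case: ltnP; lia.
rewrite -[X in X * _](card_ord (ssl_n x)) -sum_nat_const; apply: leq_sum => v _.
apply: leq_trans (geq_minr _ _) (leq_trans (geq_minl _ _) _).
exact: leq_bigmax.
Qed.

End SSL.

Lemma directed_ssl_approx :
  poly_time_approx (P := directed_ssl)
    (fun x : ssl => H (minn (\sum_(v < ssl_n x) ssl_d v)
                            (ssl_n x * \max_(u < ssl_n x) ssl_p u))).
Proof.
apply: (@poly_time_approx_intro directed_ssl _ (fun x : ssl => alg_ssl (raw_ssl x))).
  apply: (@poly_call _ (@enc_instance directed_ssl) _ _ _ _ _ _ poly_alg_ssl).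
  by apply: poly_recode => x; exact: enc_sslE.
move=> /= x [S0 /ssl_feasibleE F0]; exists (chosen (ssl_net x) (@ssl_item x)).
have neq := @ssl_demands_neq x; have star := @ssl_item_star x.
have idx := @ssl_item_idx x; have den := @ssl_item_den x.
split.
- rewrite -marks_chosen /alg_ssl raw_ssl_itemsE raw_ssl_netE; congr (encode (marks _ (iota 0 _))).
  by rewrite /= size_map size_enum_ord.
- by apply/ssl_feasibleE; exact: (chosen_full neq idx star den F0).
- by move=> S /ssl_feasibleE; exact: (core_ratio neq idx star den (@ssl_item_price x) (@ssl_gain_le x)).
Qed.

Theorem theorem3 :
  [/\ poly_time_approx (P := sna_edge_costs)
        (fun x : sna_ec => H #|sna_D x|),
      poly_time_approx (P := sna_node_costs)
        (fun x : sna_nc => H (minn (sna_rD x) (#|sna_D x| * sna_pmax x)))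
    & poly_time_approx (P := directed_ssl)
        (fun x : ssl =>
           H (minn (\sum_(v < ssl_n x) ssl_d v)
                   (ssl_n x * \max_(u < ssl_n x) ssl_p u)))].
Proof.
by split; [exact: sna_edge_costs_approx | exact: sna_node_costs_approx | exact: directed_ssl_approx].
Qed.
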